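(* Let $\lambda$ be a frequency. The following are equivalent: (i) $\lambda$ is hypercontractive; (ii) $\tau_\sigma$ maps $\mathcal{H}_2(\lambda)$ into $\mathcal{H}_{2k}(\lambda)$ for every $\sigma>0$ and every $k\in\mathbb{N}$. If additionally $\lambda$ satisfies $\limsup_{n\to\infty}\frac{\log\log n}{\lambda_n}=0$, then both are also equivalent to: (iii) for every integer $k\ge 2$, $$\lim_{j\to\infty}\ \sup_{\emptyset\ne A\subseteq\lambda\cap[j,j+1)}\ \frac1j\log\Big(\frac{E_k(A)^{1/k}}{\#A}\Big)=0,$$ where the supremum is understood to be $0$ when $\lambda\cap[j,j+1)=\emptyset$.
   Context: A frequency is a strictly increasing sequence $\lambda=(\lambda_n)_{n\ge1}$ of non-negative real numbers tending to $\infty$; $\lambda$ also denotes the set $\{\lambda_n : n\ge 1\}$. A $\lambda$-Dirichlet series is a formal series $D=\sum a_ne^{-\lambda_ns}$ with complex coefficients $(a_n)$; it is a $\lambda$-Dirichlet polynomial if only finitely many $a_n$ are non-zero. For $1\le p<\infty$ and a $\lambda$-Dirichlet polynomial $D$, $$\|D\|_p=\lim_{T\to\infty}\Big(\frac1{2T}\int_{-T}^T\Big|\sum_n a_ne^{-\lambda_nit}\Big|^pdt\Big)^{1/p}.$$ The Hardy space $\mathcal{H}_p(\lambda)$ is the completion of the space of $\lambda$-Dirichlet polynomials under $\|\cdot\|_p$; the coefficient functionals $D\mapsto a_n$ extend continuously ($|a_n|\le\|D\|_p$) and elements of $\mathcal{H}_p(\lambda)$ are identified with the formal $\lambda$-Dirichlet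 series given by their coefficients. For $\sigma\in\mathbb{R}$, the translation operator is $\tau_\sigma(\sum a_ne^{-\lambda_ns})=\sum a_ne^{-\lambda_n\sigma}e^{-\lambda_ns}$. ''$\tau_\sigma$ maps $\mathcal{H}_p(\lambda)$ into $\mathcal{H}_q(\lambda)$'' means $\tau_\sigma D\in\mathcal{H}_q(\lambda)$ for all $D\in\mathcal{H}_p(\lambda)$ (by a closed-graph argument the resulting operator is then bounded). The frequency $\lambda$ is hypercontractive if $\tau_\sigma:\mathcal{H}_p(\lambda)\to\mathcal{H}_q(\lambda)$ is well defined and continuous for every $1\le p<q<\infty$ and every $\sigma>0$. The $k$-th additive energy of a finite set $A\subseteq\mathbb{R}$ is $E_k(A)=\#\{(x,y)\in A^{2k}: x_1+\dots+x_k=y_1+\dots+y_k\}$, where $x=(x_1,\dots,x_k)$ and $y=(y_1,\dots,y_k)$ are in $A^k$. *)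

(* Defs.v *)
From HB Require Import structures.
From mathcomp Require Import all_boot all_order all_algebra finmap.
From mathcomp Require Import all_classical all_reals all_analysis.
From mathcomp.real_closed Require Import complex.

Set Implicit Arguments.
Unset Strict Implicit.
Unset Printing Implicit Defensive.

Import Order.TTheory GRing.Theory Num.Theory.
Import numFieldTopology.Exports numFieldNormedType.Exports.

Local Open Scope classical_set_scope.
Local Open Scope ring_scope.
Local Open Scope complex_scope.

(* Indices start at 0: [lam n] is the term written lambda_(n+1) when
   frequencies are indexed by n >= 1. *)
Definition frequency (R : realType) (lam : nat -> R) : Prop :=
  [/\ {homo lam : m n / (m < n)%N >-> m < n},
      forall n, 0 <= lam n
    & lam n @[n --> \oo] --> +oo].

(* A formal lambda-Dirichlet series is its coefficient sequence
   [D : nat -> R[i]].  A lambda-Dirichlet polynomial is a finitely supported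
   coefficient sequence; these form the type [{poly R[i]}], used here only as
   an additive group, with [P`_n] the coefficient of e^(- lambda_n s). *)

Definition dirichlet_line (R : realType) (lam : nat -> R) (P : {poly R[i]})
    (t : R) : R[i] :=
  \sum_(n < size P) P`_n * (cos (lam n * t) -i* sin (lam n * t)).

Definition dirichlet_norm (R : realType) (lam : nat -> R) (p : R)
    (P : {poly R[i]}) : R :=
  lim (((2 * T)^-1 *
        \int[lebesgue_measure]_(t in `[- T, T])
          (Normc.normc (dirichlet_line lam P t) `^ p)) `^ p^-1 @[T --> +oo]).

Definition dirichlet_cauchy (R : realType) (lam : nat -> R) (p : R)
    (P : nat -> {poly R[i]}) : Prop :=
  forall e : R, 0 < e -> exists N : nat, forall m n : nat,
    (N <= m)%N -> (N <= n)%N -> dirichlet_norm lam p (P m - P n) < e.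

(* The elements of the completion are the classes of norm-Cauchy sequences of
   polynomials; the n-th coefficient of such a class is the limit of the n-th
   coefficients.  [represents lam p P D]: the class of [P] is an element of the
   completion whose formal series is [D]. *)
Definition represents (R : realType) (lam : nat -> R) (p : R)
    (P : nat -> {poly R[i]}) (D : nat -> R[i]) : Prop :=
  dirichlet_cauchy lam p P /\
  forall n, Normc.normc ((P m)`_n - D n) @[m --> \oo] --> (0 : R).

Definition hardy (R : realType) (lam : nat -> R) (p : R) : set (nat -> R[i]) :=
  [set D | exists P, represents lam p P D].

(* The norm of the completion: the limit of the norms along a representing
   sequence.  It does not depend on that sequence, because an element of the
   completion is determined by its coefficients. *)
Definition hardy_norm (R : realType) (lam : nat -> R) (p : R)
    (D : nat -> R[i]) : R :=
  get [set v : R | exists2 P, represents lam p P D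
                   & dirichlet_norm lam p (P m) @[m --> \oo] --> v].

Definition translation (R : realType) (lam : nat -> R) (sigma : R)
    (D : nat -> R[i]) : nat -> R[i] :=
  fun n => D n * (expR (- (lam n * sigma)))%:C.

Definition maps_into (R : realType) (lam : nat -> R) (sigma p q : R) : Prop :=
  forall D, hardy lam p D -> hardy lam q (translation lam sigma D).

Definition translation_continuous (R : realType) (lam : nat -> R)
    (sigma p q : R) : Prop :=
  forall D, hardy lam p D -> forall e : R, 0 < e ->
  exists2 d : R, 0 < d & forall E, hardy lam p E ->
    hardy_norm lam p (E \- D) < d ->
    hardy_norm lam q (translation lam sigma E \- translation lam sigma D) < e.

Definition hypercontractive (R : realType) (lam : nat -> R) : Prop :=
  forall p q sigma : R, 1 <= p -> p < q -> 0 < sigma ->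
    maps_into lam sigma p q /\ translation_continuous lam sigma p q.

Definition additive_energy (R : realType) (k : nat) (A : {fset R}) : nat :=
  #|[set xy : {ffun 'I_k -> A} * {ffun 'I_k -> A} |
      \sum_i val (xy.1 i) == \sum_i val (xy.2 i)]|.

(* Only finitely many lambda_n lie in [j, j + 1), so the supremum is over a
   finite set; when no lambda_n lies there it is [sup set0 = 0] (lemma
   [sup0]). *)
Definition energy_exponent (R : realType) (lam : nat -> R) (k j : nat) : R :=
  sup [set j%:R^-1 *
           ln ((additive_energy k A)%:R `^ k%:R^-1 / (#|` A|)%:R) | A in
       [set A : {fset R} | A != fset0
          /\ [set` A] `<=` range lam `&` `[j%:R, j%:R + 1[ ]].

(* Main.v *)
(* Everything is read off one property of the blocks of [lam] in [j, j + 1):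
   on Dirichlet polynomials supported there, the 2k-norm is at most
   [C_e * exp (e j)] times the 2-norm, for all [k] and [e > 0].

   The 2k-th power of the 2k-norm is a sum, over pairs of k-tuples with equal
   frequency sums, of products of coefficients; so replacing the coefficients
   by nonnegative majorants increases it. If [tau_sigma] maps H_2 into H_2k,
   glue near-extremal nonnegative polynomials of the blocks, with weights
   [exp (- s j)], into one element of H_2: by a Fatou argument its image
   dominates each piece, which gives the block property. On indicator
   polynomials the property is the energy condition; conversely a polynomial in
   a block of at most [exp (exp (e j))] terms splits into [exp (e j)] level sets.

   Given the block property, summing over blocks bounds [tau_sigma] from H_2 to
   H_2k. To start from H_1, cut the spectrum with Gaussian-like multipliers,
   which are contractions for every norm because they are averages of
   translations, and interpolate the 2-norm between the 1-norm and the
   4-norm. *)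
Require Import Defs.
From HB Require Import structures.
From mathcomp Require Import all_boot all_order all_algebra finmap.
From mathcomp Require Import all_classical all_reals all_analysis.
From mathcomp.real_closed Require Import complex.
From mathcomp Require Import measurable_realfun ring lra.

Set Implicit Arguments.
Unset Strict Implicit.
Unset Printing Implicit Defensive.

Import Order.TTheory GRing.Theory Num.Theory.
Import numFieldTopology.Exports numFieldNormedType.Exports.

Local Open Scope classical_set_scope.
Local Open Scope ring_scope.

(** * Mean values *)

Section Means.
Context {R : realType}.
Implicit Types (f g h : R -> R) (t T : R).
Local Notation mu := (@lebesgue_measure R).

(** The norm is a [lim] over growing intervals, so existence of that limit has to be proved. For
    even exponents it is read from the coefficients. For general [p], the function
    $|P|^p=(|P|^2)^{p/2}$ is a uniform limit of trigonometric polynomials, by Bernstein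
    approximation of $u^{p/2}$. Inequalities between norms are then averaged pointwise inequalities.

    Two obstacles shape the rest. Sharp cutoffs to blocks are controlled for the 2-norm by Parseval,
    but nothing comparable is at hand for the 1-norm. And [hardy_norm] is a value taken along some
    representing sequence, so continuity of $\tau_\sigma$ requires that a Cauchy sequence whose
    coefficients tend to 0 has norms tending to 0. Gaussian cutoffs answer both.

    One glued series tests all blocks at once, which makes the bound uniform in [j]. In the
    level-set argument, coefficients below $e^{-I}$ contribute at most 1 in total as soon as $e^I$
    exceeds the number of terms, so [I] levels suffice; the iterated logarithm in the growth
    condition says exactly that [I] may be taken of size $e^{\epsilon j}$. *)

Definition avg f T : R := (2 * T)^-1 * \int[mu]_(t in `[- T, T]) f t.

Definition has_mean f (l : R) := avg f T @[T --> +oo] --> l.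

Definition bmeas f := measurable_fun setT f /\ exists B, forall t, `|f t| <= B.

Lemma bmeas_integrable f (T : R) :
  bmeas f -> mu.-integrable `[- T, T] (EFin \o f).
Proof.
move=> [mf [B fB]]; apply: measurable_bounded_integrable => //.
- by rewrite /= lebesgue_measure_itv /=; case: ifP => _; rewrite ltry.
- exact: measurable_funTS.
- by exists B; split; [exact: num_real|move=> M BM t _; exact: le_trans (fB t) (ltW BM)].
Qed.

Lemma bmeas_cst c : bmeas (fun=> c).
Proof. by split; [exact: measurable_cst|exists `|c|]. Qed.

Lemma bmeas_add f g : bmeas f -> bmeas g -> bmeas (fun t => f t + g t).
Proof.
move=> [mf [A fA]] [mg [B gB]]; split; first exact: measurable_funD.
by exists (A + B) => t; exact: le_trans (ler_normD _ _) (lerD _ _).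
Qed.

Lemma bmeas_mul f g : bmeas f -> bmeas g -> bmeas (fun t => f t * g t).
Proof.
move=> [mf [A fA]] [mg [B gB]]; split; first exact: measurable_funM.
by exists (A * B) => t; rewrite normrM; exact: ler_pM.
Qed.

Lemma bmeas_scale c f : bmeas f -> bmeas (fun t => c * f t).
Proof. by move=> bf; apply: bmeas_mul => //; exact: bmeas_cst. Qed.

Lemma bmeas_continuous f B : continuous f -> (forall t, `|f t| <= B) -> bmeas f.
Proof. by move=> cf fB; split; [exact: continuous_measurable_fun|exists B]. Qed.

Lemma bmeas_powR f p : bmeas f -> 0 <= p -> (forall t, 0 <= f t) ->
  bmeas (fun t => f t `^ p).
Proof.
move=> [mf [B fB]] p0 f0; split.
  exact: (measurableT_comp (measurable_powR p) mf).
exists (B `^ p) => t; rewrite ger0_norm ?powR_ge0//.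
have := fB t; rewrite ger0_norm// => ftB.
by apply: ge0_ler_powR => //; rewrite nnegrE // (le_trans _ ftB).
Qed.

Lemma has_mean_cst c : has_mean (fun=> c) c.
Proof.
apply: cvg_near_cst; near=> T.
have T0 : 0 < T by near: T; exact: nbhs_pinfty_gt.
rewrite /avg Rintegral_cst//= lebesgue_measure_itv /= lte_fin gtrN// /=.
by field; rewrite gt_eqF.
Unshelve. all: end_near. Qed.

Lemma has_meanD f g l m : bmeas f -> bmeas g ->
  has_mean f l -> has_mean g m -> has_mean (fun t => f t + g t) (l + m).
Proof.
move=> bf bg fl gm; rewrite /has_mean.
rewrite (_ : avg _ = avg f \+ avg g); first exact: cvgD fl gm.
by apply/funext => T /=; rewrite /avg RintegralD ?mulrDr//; exact: bmeas_integrable.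
Qed.

Lemma has_meanZ c f l : bmeas f -> has_mean f l ->
  has_mean (fun t => c * f t) (c * l).
Proof.
move=> bf fl; rewrite /has_mean.
rewrite (_ : avg _ = fun T => c * avg f T); first exact: cvgMr fl.
apply/funext => T /=; rewrite /avg RintegralZl; last exact: bmeas_integrable.
  by rewrite mulrCA.
exact: measurable_itv.
Qed.

Lemma has_mean_le f g l m : bmeas f -> bmeas g -> (forall t, f t <= g t) ->
  has_mean f l -> has_mean g m -> l <= m.
Proof.
move=> bf bg fg fl gm; apply: (ler_cvg_to fl gm); near=> T.
have T0 : 0 < T by near: T; exact: nbhs_pinfty_gt.
apply: ler_wpM2l; first by rewrite invr_ge0 mulr_ge0// ltW.
by apply: le_Rintegral => //; exact: bmeas_integrable.
Unshelve. all: end_near. Qed.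

Lemma has_mean_uniq f l m : has_mean f l -> has_mean f m -> l = m.
Proof. by move=> fl fm; apply: (cvg_unique _ fl fm). Qed.

Lemma is_derive_affine (c phi x : R) :
  is_derive x (1 : R) (fun t => c * t + phi) c.
Proof. by apply: is_derive_eq; rewrite addr0 /GRing.scale /= mulr1. Qed.

Lemma Rintegral_cos (theta phi T : R) : theta != 0 -> 0 < T ->
  \int[mu]_(t in `[- T, T]) cos (theta * t + phi) =
  theta^-1 * (sin (theta * T + phi) - sin (phi - theta * T)).
Proof.
move=> th0 T0.
pose F t := theta^-1 * sin (theta * t + phi).
have dF (x : R) : is_derive x (1 : R) F (cos (theta * x + phi)).
  have h := is_derive_affine theta phi x.
  have hs : is_derive x (1 : R) (fun t => sin (theta * t + phi)) (theta * cos (theta * x + phi)).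
    by apply: is_derive_eq; rewrite /GRing.scale /= mulrC.
  apply: is_derive_eq. rewrite /GRing.scale /= ; field; exact: th0.
have cF : continuous F.
  move=> x; apply: differentiable_continuous; apply/derivable1_diffP.
  by have [] := dF x.
rewrite /Rintegral (@continuous_FTC2 _ _ F).
- by rewrite -EFinB /= /F mulrBr [theta * - T]mulrN [- _ + phi]addrC.
- by rewrite gtrN.
- apply: continuous_subspaceT => x.
  apply: (@continuous_comp _ _ _ (fun t => theta * t + phi) cos); last exact: continuous_cos.
  apply: differentiable_continuous; apply/derivable1_diffP.
  by have [] := is_derive_affine theta phi x.
- split; first by move=> x _; have [] := dF x.
  + exact: cvg_at_right_filter (cF _).
  + exact: cvg_at_left_filter (cF _).
- by move=> x _; rewrite derive1E; have [_ ->] := dF x.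
Qed.

(** A nonzero frequency has a bounded antiderivative, so its averages are $O(1/T)$. *)
Lemma has_mean_cos (theta phi : R) :
  has_mean (fun t => cos (theta * t + phi)) (if theta == 0 then cos phi else 0).
Proof.
case: eqP => [->|/eqP th0].
  by under [X in has_mean X _]eq_fun => t do rewrite mul0r add0r; exact: has_mean_cst.
apply/cvgr0Pnorm_le => e e0; near=> T.
have T0 : 0 < T by near: T; exact: nbhs_pinfty_gt.
rewrite /avg Rintegral_cos// !normrM !normfV.
have h : `|sin (theta * T + phi) - sin (phi - theta * T)| <= 2.
  apply: (le_trans (ler_normB _ _)); rewrite -[2]/(1 + 1).
  by apply: lerD; exact: sin_max.
have -> : `|2 * T| = 2 * T by rewrite ger0_norm// mulr_ge0// ltW.
rewrite mulrA -ler_pdivlMl ?mulr_gt0 ?invr_gt0 ?normr_gt0 ?mulr_gt0//.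
apply: le_trans h _.
have nth0 : `|theta| != 0 by rewrite normr_eq0.
have -> : ((2 * T)^-1 * `|theta|^-1)^-1 * e = (`|theta| * e * T) * 2.
  by field; rewrite nth0 (gt_eqF T0).
have : (`|theta| * e)^-1 <= T by near: T; apply: nbhs_pinfty_ge; exact: num_real.
have te : 0 < `|theta| * e by rewrite mulr_gt0// normr_gt0.
rewrite -(ler_pM2l te) mulfV ?gt_eqF//; lra.
Unshelve. all: end_near. Qed.

End Means.

(** * Trigonometric polynomials *)

Section Approximation.
Context {R : realType}.
Implicit Types (f g h : R -> R) (t T : R).

(** Carrying a phase instead of separate sines makes closure under translation immediate; products
    are reduced by [cosM]. *)
Inductive tpoly : (R -> R) -> Prop :=
| tpoly_cos c theta phi : tpoly (fun t => c * cos (theta * t + phi))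
| tpoly_add f g : tpoly f -> tpoly g -> tpoly (fun t => f t + g t).

Lemma tpoly_cst c : tpoly (fun=> c).
Proof.
rewrite (_ : (fun=> c) = fun t => c * cos (0 * t + 0)); first exact: tpoly_cos.
by apply/funext => t; rewrite mul0r addr0 cos0 mulr1.
Qed.

Lemma bmeas_cos c theta phi : bmeas (fun t : R => c * cos (theta * t + phi)).
Proof.
apply/bmeas_scale/(@bmeas_continuous _ _ 1) => [t|t]; last exact: cos_max.
apply: (@continuous_comp _ _ _ (fun t => theta * t + phi) cos); last exact: continuous_cos.
apply: differentiable_continuous; apply/derivable1_diffP.
by have [] := is_derive_affine theta phi t.
Qed.

Lemma tpoly_bmeas f : tpoly f -> bmeas f.
Proof. by elim=> [c theta phi|{}f g _ bf _ bg]; [exact: bmeas_cos|exact: bmeas_add]. Qed.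

Lemma tpoly_shift f s : tpoly f -> tpoly (fun t => f (t + s)).
Proof.
elim=> [c theta phi|{}f g _ bf _ bg]; last exact: tpoly_add bf bg.
under [X in tpoly X]eq_fun => t do rewrite mulrDr -addrA.
exact: tpoly_cos.
Qed.

Lemma tpoly_scale c f : tpoly f -> tpoly (fun t => c * f t).
Proof.
elim=> [d theta phi|{}f g _ bf _ bg].
  under [X in tpoly X]eq_fun => t do rewrite mulrA; exact: tpoly_cos.
under [X in tpoly X]eq_fun => t do rewrite mulrDr; exact: tpoly_add.
Qed.

Lemma cosM (x y : R) : cos x * cos y = 2^-1 * (cos (x + y) + cos (x - y)).
Proof. by rewrite cosD cosB; field. Qed.

Lemma tpoly_mul f g : tpoly f -> tpoly g -> tpoly (fun t => f t * g t).
Proof.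
elim=> [c th phi|{}f1 f2 _ h1 _ h2] tg; last first.
  under [X in tpoly X]eq_fun => t do rewrite mulrDl; exact: tpoly_add (h1 tg) (h2 tg).
elim: tg => [d th' phi'|g1 g2 _ h1 _ h2]; last first.
  under [X in tpoly X]eq_fun => t do rewrite mulrDr; exact: tpoly_add.
rewrite (_ : (fun _ => _) = fun t => (c * d / 2) * cos ((th + th') * t + (phi + phi')) +
  (c * d / 2) * cos ((th - th') * t + (phi - phi'))).
  by apply: tpoly_add; exact: tpoly_cos.
apply/funext => t; rewrite mulrACA cosM.
have -> : th * t + phi + (th' * t + phi') = (th + th') * t + (phi + phi') by ring.
have -> : th * t + phi - (th' * t + phi') = (th - th') * t + (phi - phi') by ring.
by field.
Qed.

(** A translation changes each phase by [theta * s], which vanishes for the only frequency that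
    contributes to the mean. One value thus serves all translates, and vertical translations will
    preserve the norms. *)
Lemma tpoly_mean f : tpoly f ->
  exists l, forall s, has_mean (fun t => f (t + s)) l.
Proof.
elim=> [c th phi|{}f g tf [l fl] tg [m gm]].
  exists (c * (if th == 0 then cos phi else 0)) => s.
  under [X in has_mean X _]eq_fun => t do rewrite mulrDr -addrA.
  apply: has_meanZ; first by have := bmeas_cos 1 th (th * s + phi); under eq_fun do rewrite mul1r.
  have := @has_mean_cos R th (th * s + phi).
  by case: eqP => // ->; rewrite mul0r add0r.
exists (l + m) => s; apply: has_meanD => //; exact/tpoly_bmeas/tpoly_shift.
Qed.

(* The mean of [phi] at the number of successes in [n] trials of probability
   [x], by conditioning on one trial. *)
Fixpoint bernstein (n : nat) (phi : nat -> R) (x : R) : R :=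
  if n is m.+1 then
    x * bernstein m (fun k => phi k.+1) x + (1 - x) * bernstein m phi x
  else phi 0%N.

Lemma tpoly_bernstein n phi f : tpoly f -> tpoly (fun t => bernstein n phi (f t)).
Proof.
move=> tf; elim: n phi => [|n ih] phi /=; first exact: tpoly_cst.
apply: tpoly_add; apply: tpoly_mul => //.
rewrite (_ : (fun t => 1 - f t) = fun t => 1 + (-1) * f t); last first.
  by apply/funext => t; rewrite mulN1r.
by apply: tpoly_add; [exact: tpoly_cst|exact: tpoly_scale].
Qed.

Lemma bernstein_le n phi psi x : 0 <= x <= 1 ->
  (forall k, (k <= n)%N -> phi k <= psi k) -> bernstein n phi x <= bernstein n psi x.
Proof.
move=> /andP[x0 x1]; elim: n phi psi => [|n ih] phi psi le_phi /=; first exact: le_phi.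
apply: lerD; apply: ler_wpM2l; rewrite ?subr_ge0//; apply: ih => k kn; apply: le_phi => //.
exact: leq_trans kn _.
Qed.

(** Variance plus squared bias of the binomial law. Conditioning on one trial shifts [k], which the
    free parameter [c] absorbs. *)
Lemma bernstein_sqr n a b c x :
  bernstein n (fun k => a + b * (k%:R - c) ^+ 2) x =
  a + b * (n%:R * x * (1 - x) + (n%:R * x - c) ^+ 2).
Proof.
elim: n a b c => [|n ih] a b c /=; first by rewrite mul0r; ring.
rewrite ih (_ : (fun k => _) = fun k => a + b * (k%:R - (c - 1)) ^+ 2); last first.
  by apply/funext => k; rewrite -natr1; ring.
by rewrite ih -natr1; ring.
Qed.

(** A modulus of continuity of the form $e+K(x-y)^2$ is averaged exactly by [bernstein_sqr]: the
    quadratic term becomes $Kx(1-x)/n$. *)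
Lemma bernstein_approx (phi : R -> R) n e K x : (0 < n)%N -> 0 <= x <= 1 -> 0 <= K ->
  (forall x y, 0 <= x <= 1 -> 0 <= y <= 1 -> `|phi x - phi y| <= e + K * (x - y) ^+ 2) ->
  `|bernstein n (fun k => phi (k%:R / n%:R)) x - phi x| <= e + K / n%:R.
Proof.
move=> n0 x01 K0 modphi.
have nR0 : 0 < n%:R :> R by rewrite ltr0n.
have dk k : (k <= n)%N ->
    `|phi (k%:R / n%:R) - phi x| <= e + K / n%:R ^+ 2 * (k%:R - n%:R * x) ^+ 2.
  move=> kn; apply: (le_trans (modphi _ _ _ x01)).
    by rewrite divr_ge0//= ler_pdivrMr// mul1r ler_nat.
  rewrite le_eqVlt; apply/orP; left; apply/eqP; congr (_ + _).
  by field; rewrite gt_eqF.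
have end_le : K / n%:R ^+ 2 * (n%:R * x * (1 - x) + (n%:R * x - n%:R * x) ^+ 2) <= K / n%:R.
  rewrite (_ : K / _ * _ = K / n%:R * (x * (1 - x))); last by field; rewrite gt_eqF.
  rewrite -[leRHS]mulr1; apply: ler_wpM2l; first by rewrite divr_ge0// ltW.
  by move: x01 => /andP[x0 x1]; nra.
rewrite ler_distl; apply/andP; split.
  have := @bernstein_le n (fun k => phi x - e + - (K / n%:R ^+ 2) * (k%:R - n%:R * x) ^+ 2)
    (fun k => phi (k%:R / n%:R)) x x01.
  rewrite bernstein_sqr => H.
  apply: le_trans (H _); last first.
    by move=> k kn; have := dk k kn; rewrite ler_distl => /andP[+ _]; lra.
  by move: end_le; rewrite mulNr; lra.
have := @bernstein_le n (fun k => phi (k%:R / n%:R))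
  (fun k => phi x + e + (K / n%:R ^+ 2) * (k%:R - n%:R * x) ^+ 2) x x01.
rewrite bernstein_sqr => H.
apply: (le_trans (H _)).
  by move=> k kn; have := dk k kn; rewrite ler_distl => /andP[_]; lra.
by move: end_le; lra.
Qed.

(** * Real powers of nonnegative trigonometric polynomials *)

Lemma powR_subadd (a x y : R) : 0 < a -> a <= 1 -> 0 <= x -> 0 <= y ->
  (x + y) `^ a <= x `^ a + y `^ a.
Proof.
move=> a0 a1; rewrite le_eqVlt => /predU1P[<- y0|x0].
  by rewrite add0r powR0 ?gt_eqF// add0r.
rewrite le_eqVlt => /predU1P[<-|y0].
  by rewrite addr0 [0 `^ _]powR0 ?gt_eqF// addr0.
have xy0 : 0 < x + y by rewrite addr_gt0.
(* A number in $[0,1]$ is at most its [a]-th power, and the two fractions of [x + y] sum to 1. *)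
have h z : 0 < z -> z <= x + y -> z / (x + y) * (x + y) `^ a <= z `^ a.
  move=> z0 zxy; have -> : z `^ a = (z / (x + y)) `^ a * (x + y) `^ a.
    by rewrite -powRM ?divr_ge0 ?ltW// divfK// gt_eqF.
  apply: ler_wpM2r; first exact: powR_ge0.
  by apply: ger1_powR => //; rewrite divr_gt0//= ler_pdivrMr// mul1r.
have := lerD (h x x0 _) (h y y0 _).
rewrite -mulrDl -mulrDl mulfV ?gt_eqF// mul1r; apply.
  by rewrite lerDl ltW.
by rewrite lerDr ltW.
Qed.

Lemma powR_dist (a x y : R) : 0 < a -> a <= 1 -> 0 <= x -> 0 <= y ->
  `|x `^ a - y `^ a| <= `|x - y| `^ a.
Proof.
move=> a0 a1; wlog xy : x y / y <= x => [hw x0 y0|].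
  by have [/hw|/ltW/hw] := leP y x; [exact|rewrite distrC (distrC x); exact].
move=> x0 y0; rewrite [in leRHS]ger0_norm ?subr_ge0// ger0_norm; last first.
  by rewrite subr_ge0 ge0_ler_powR// ltW.
rewrite lerBlDr; apply: le_trans (powR_subadd a0 a1 _ y0); last by rewrite subr_ge0.
by rewrite subrK.
Qed.

Lemma exprn_dist01 n (u v : R) : 0 <= u <= 1 -> 0 <= v <= 1 ->
  `|u ^+ n - v ^+ n| <= n%:R * `|u - v|.
Proof.
move=> u01 v01; elim: n => [|n ih]; first by rewrite !expr0 subrr normr0 mul0r.
rewrite !exprS.
have -> : u * u ^+ n - v * v ^+ n = u * (u ^+ n - v ^+ n) + (u - v) * v ^+ n by ring.
apply: (le_trans (ler_normD _ _)); rewrite -natr1 [in leRHS]mulrDl mul1r !normrM.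
case/andP: u01 => u0 u1; case/andP: v01 => v0 v1.
apply: lerD.
  by apply: le_trans ih; rewrite ler_piMl// ger0_norm.
by rewrite ler_piMr// ger0_norm ?exprn_ge0// exprn_ile1.
Qed.

Lemma powR_le1 (a x : R) : 0 <= a -> 0 <= x <= 1 -> 0 <= x `^ a <= 1.
Proof.
move=> a0 /andP[x0 x1]; rewrite powR_ge0 /=.
have := ge0_ler_powR a0 (x := x) (y := 1); rewrite powR1; apply=> //.
by rewrite nnegrE.
Qed.

(** Write $x^a=(x^b)^n$ with $b=a/n\le1$: the outer power is [n]-Lipschitz on $[0,1]$, and the inner
    one satisfies $|x^b-y^b|\le|x-y|^b$. *)
Lemma powR_modulus (a e : R) : 0 < a -> 0 < e -> exists2 K, 0 <= K &
  forall x y, 0 <= x <= 1 -> 0 <= y <= 1 ->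
    `|x `^ a - y `^ a| <= e + K * (x - y) ^+ 2.
Proof.
move=> a0 e0.
pose n := (Num.truncn a).+1; have an : a <= n%:R by apply/ltW; rewrite /n truncnS_gt.
have n0 : 0 < n%:R :> R by rewrite ltr0n.
pose b := a / n%:R; have b0 : 0 < b by rewrite divr_gt0.
have b1 : b <= 1 by rewrite ler_pdivrMr// mul1r.
(* [d] solves $n d^b=e$, which settles $|x-y|\le d$; at larger distances $K d^2=n$ already dominates
   the trivial bound. *)
pose d := (e / n%:R) `^ b^-1; have d0 : 0 < d by rewrite powR_gt0// divr_gt0.
exists (n%:R / d ^+ 2); first by rewrite divr_ge0// ltW// exprn_gt0.
move=> x y x01 y01.
have powE z : z `^ a = (z `^ b) ^+ n.
  by rewrite -powR_mulrn ?powR_ge0// -powRrM /b divfK// gt_eqF.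
rewrite !powE; apply: (le_trans (exprn_dist01 _ (powR_le1 (ltW b0) x01) (powR_le1 (ltW b0) y01))).
have [/andP[x0 x1] /andP[y0 y1]] := (x01, y01).
apply: (@le_trans _ _ (n%:R * `|x - y| `^ b)); first by rewrite ler_pM2l// powR_dist.
have nn := normr_ge0 (x - y).
have [xyd|dxy] := leP `|x - y| d.
  have hb : `|x - y| `^ b <= d `^ b by apply: ge0_ler_powR; rewrite ?nnegrE// ltW.
  have db : d `^ b = e / n%:R by rewrite /d -powRrM mulVf ?gt_eqF// powRr1// divr_ge0// ltW.
  rewrite -[leLHS]addr0; apply: lerD; last by rewrite mulr_ge0 ?sqr_ge0// divr_ge0// ltW// exprn_gt0.
  by rewrite mulrC -ler_pdivlMr// -db.
have /andP[_ h1] : 0 <= `|x - y| `^ b <= 1.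
  by apply: powR_le1; [exact: ltW|rewrite nn /= ler_norml; apply/andP; split; lra].
apply: (@le_trans _ _ (n%:R * 1)); first by rewrite ler_pM2l.
rewrite mulr1 -[leLHS]add0r; apply: lerD; first exact: ltW.
rewrite -mulrA ler_peMr ?(ltW n0)//.
rewrite [leRHS]mulrC ler_pdivlMr ?exprn_gt0// mul1r.
by rewrite -[leRHS]real_normK ?num_real//; apply: lerXn2r; rewrite ?nnegrE// ltW.
Qed.

Lemma tpoly_powR_approx f (a e : R) : tpoly f -> 0 < a -> 0 < e ->
  (forall t, 0 <= f t) ->
  exists2 h, tpoly h & forall t, `|f t `^ a - h t| <= e.
Proof.
move=> tf a0 e0 f0.
have [_ [B0 fB0]] := tpoly_bmeas tf.
pose B := `|B0| + 1; have B1 : 0 < B by rewrite ltr_wpDl.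
have fB t : f t <= B.
  by rewrite (le_trans (ler_norm _))// (le_trans (fB0 t))// (le_trans (ler_norm _))// lerDl.
have Ba0 : 0 < B `^ a by rewrite powR_gt0.
pose d := e / B `^ a / 2; have d0 : 0 < d by rewrite !divr_gt0.
have [K K0 modK] := powR_modulus a0 d0.
pose n := (Num.truncn (K / d)).+1.
have nR0 : 0 < n%:R :> R by rewrite ltr0n.
have Kn : K / n%:R <= d.
  by rewrite ler_pdivrMr// mulrC -ler_pdivrMr//; apply/ltW; rewrite /n truncnS_gt.
pose h t := B `^ a * bernstein n (fun k => (k%:R / n%:R) `^ a) (B^-1 * f t).
exists h.
  apply/tpoly_scale/(@tpoly_bernstein n (fun k => (k%:R / n%:R) `^ a) (fun t => B^-1 * f t)).
  exact: tpoly_scale.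
move=> t.
have x01 : 0 <= B^-1 * f t <= 1.
  apply/andP; split; first by rewrite mulr_ge0// invr_ge0 ltW.
  by rewrite [_^-1 * _]mulrC ler_pdivrMr// mul1r.
have := @bernstein_approx (fun x => x `^ a) n d K _ isT x01 K0 modK.
rewrite (_ : f t `^ a = B `^ a * (B^-1 * f t) `^ a); last first.
  by rewrite -powRM ?(ltW B1) ?(andP x01).1// mulrA divff ?mul1r// gt_eqF.
rewrite /h -mulrBr normrM gtr0_norm// distrC => Hb.
rewrite -ler_pdivlMl//; apply: (le_trans Hb).
have -> : (B `^ a)^-1 * e = d + d by rewrite /d; field; rewrite gt_eqF.
by rewrite lerD2l.
Qed.

Lemma avg_dist f g e T : 0 < T -> bmeas f -> bmeas g ->
  (forall t, `|f t - g t| <= e) -> `|avg f T - avg g T| <= e.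
Proof.
move=> T0 bf bg fg.
have avgc c : avg (fun=> c) T = c.
  rewrite /avg Rintegral_cst//= lebesgue_measure_itv /= lte_fin gtrN// /=.
  by field; rewrite gt_eqF.
have avg_le u v : bmeas u -> bmeas v -> (forall t, u t <= v t) -> avg u T <= avg v T.
  move=> bu bv uv; apply: ler_wpM2l; first by rewrite invr_ge0 mulr_ge0// ltW.
  by apply: le_Rintegral => //; exact: bmeas_integrable.
have avgD u c : bmeas u -> avg (fun t => u t + c) T = avg u T + c.
  move=> bu; rewrite -[in RHS](avgc c) /avg RintegralD ?mulrDr//; apply: bmeas_integrable => //.
  exact: bmeas_cst.
rewrite ler_distlC; apply/andP; split.
  rewrite -avgD//; apply: avg_le => //; first exact/bmeas_add/bmeas_cst.
  by move=> t; have := fg t; rewrite ler_distlC => /andP[].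
rewrite -avgD//; apply: avg_le => //; first exact/bmeas_add/bmeas_cst.
by move=> t; have := fg t; rewrite ler_distlC => /andP[].
Qed.

(** Uniformly close functions have close averages, so the averages of [f] are Cauchy. Each
    approximant has the same mean for all its translates, hence so does [f]. *)
Lemma has_mean_approx f : (forall s, bmeas (fun t => f (t + s))) ->
  (forall e, 0 < e -> exists2 h, tpoly h & forall t, `|f t - h t| <= e) ->
  exists l, forall s, has_mean (fun t => f (t + s)) l.
Proof.
move=> bf fh.
have near_mean e : 0 < e -> exists m, forall s, \forall T \near +oo,
    `|avg (fun t => f (t + s)) T - m| <= e.
  move=> e0; have [h th fhe] := fh (e / 2) ltac:(by rewrite divr_gt0).
  have [m hm] := tpoly_mean th; exists m => s.
  have e20 : 0 < e / 2 by rewrite divr_gt0.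
  have := hm s; move=> /cvgrPdist_le/(_ _ e20) hT.
  near=> T; have T0 : 0 < T by near: T; exact: nbhs_pinfty_gt.
  rewrite (_ : _ - m = (avg (fun t => f (t + s)) T - avg (fun t => h (t + s)) T) +
     (avg (fun t => h (t + s)) T - m)); last by ring.
  apply: (le_trans (ler_normD _ _)); rewrite [leRHS]splitr; apply: lerD.
    by apply: avg_dist => //; exact/tpoly_bmeas/tpoly_shift.
  by rewrite distrC; near: T.
have : cauchy_ex (avg (fun t => f (t + 0)) T @[T --> +oo]).
  move=> e e0; have [m hm] := near_mean (e / 2) ltac:(by rewrite divr_gt0).
  exists m; have := hm 0; apply: filterS => T /= hT.
  by rewrite /ball /= distrC (le_lt_trans hT)// gtr_pMr// invf_lt1// ltr1n.
move=> /cauchy_exP/cauchy_cvg fc.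
exists (lim (avg (fun t => f (t + 0)) T @[T --> +oo])) => s.
set l := lim _.
apply/cvgrPdist_le => e e0.
have e30 : 0 < e / 3 by rewrite divr_gt0.
have [m hm] := near_mean _ e30.
have lm : `|l - m| <= e / 3 + e / 3.
  near +oo_R => T.
  rewrite (_ : l - m = (l - avg (fun t => f (t + 0)) T) + (avg (fun t => f (t + 0)) T - m)); last by ring.
  apply: (le_trans (ler_normD _ _)); apply: lerD; last by near: T; exact: hm.
  by near: T; exact: (cvgrPdist_le _ _).1 fc _ e30.
have := hm s; apply: filterS => T hT.
rewrite (_ : l - _ = (l - m) - (avg (fun t => f (t + s)) T - m)); last by ring.
by apply: (le_trans (ler_normB _ _)); lra.
Unshelve. all: end_near. Qed.

Lemma has_mean_powR f (a : R) : tpoly f -> 0 < a -> (forall t, 0 <= f t) ->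
  exists l, forall s, has_mean (fun t => f (t + s) `^ a) l.
Proof.
move=> tf a0 f0; apply: (@has_mean_approx (fun t => f t `^ a)) => [s|e e0].
  apply: bmeas_powR => //; [exact/tpoly_bmeas/tpoly_shift|exact: ltW].
exact: tpoly_powR_approx.
Qed.

End Approximation.

(** * Exponential sums and their even moments *)

Section ExponentialSums.
Context {R : realType}.
Local Open Scope complex_scope.
Implicit Types (z w : R[i]) (t : R).
Local Notation normc := Normc.normc.

Lemma normc_ge0 z : 0 <= normc z.
Proof. by case: z => a b; exact: sqrtr_ge0. Qed.

(** [cre z w] and [cim z w] are the real and imaginary parts of $z\bar w$, and [cis x] is
    $e^{-ix}$. *)
Definition cre z w : R := complex.Re z * complex.Re w + complex.Im z * complex.Im w.
Definition cim z w : R := complex.Im z * complex.Re w - complex.Re z * complex.Im w.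
Definition cis (x : R) : R[i] := cos x -i* sin x.

Lemma cisD x y : cis (x + y) = cis x * cis y.
Proof.
apply/eqP; rewrite /cis cosD sinD eq_complex /=.
by apply/andP; split; apply/eqP; ring.
Qed.

Lemma cis0 : cis 0 = 1.
Proof. by rewrite /cis cos0 sin0 oppr0. Qed.

Lemma normc_cis x : normc (cis x) = 1.
Proof. by rewrite /= sqrrN cos2Dsin2 sqrtr1. Qed.

Lemma normc_sqr z : normc z ^+ 2 = cre z z.
Proof. by case: z => a b; rewrite sqr_sqrtr ?addr_ge0 ?sqr_ge0//= /cre /= !expr2. Qed.

Lemma cre_le z w : `|cre z w| <= normc z * normc w.
Proof.
rewrite -[leRHS]ger0_norm ?mulr_ge0 ?normc_ge0// -ler_sqr ?nnegrE ?normr_ge0//.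
rewrite !real_normK ?num_real// exprMn !normc_sqr /cre.
case: z w => [a b] [c d] /=; rewrite -subr_ge0.
by rewrite (_ : _ - _ = (a * d - b * c) ^+ 2) ?sqr_ge0//; ring.
Qed.

Lemma cre_real (x y : R) : cre x%:C y%:C = x * y.
Proof. by rewrite /cre /= mulr0 addr0. Qed.

Lemma normc_real (x : R) : normc x%:C = `|x|.
Proof. by rewrite /= expr0n addr0 sqrtr_sqr. Qed.

Lemma Re_sum (I : finType) (F : I -> R[i]) :
  complex.Re (\sum_i F i) = \sum_i complex.Re (F i).
Proof. by apply: (big_morph (@complex.Re R)) => [[a b] [c d]|]. Qed.

Lemma Im_sum (I : finType) (F : I -> R[i]) :
  complex.Im (\sum_i F i) = \sum_i complex.Im (F i).
Proof. by apply: (big_morph (@complex.Im R)) => [[a b] [c d]|]. Qed.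

Lemma cre_sum (I : finType) (F : I -> R[i]) :
  cre (\sum_i F i) (\sum_i F i) = \sum_i \sum_j cre (F i) (F j).
Proof.
rewrite /cre !Re_sum !Im_sum !mulr_suml -big_split; apply: eq_bigr => i _ /=.
by rewrite !mulr_sumr -big_split.
Qed.

Lemma cre_mul_cis z w x y :
  cre (z * cis x) (w * cis y) = cre z w * cos (x - y) + cim z w * sin (x - y).
Proof.
case: z w => [a b] [c d]; rewrite /cre /cim /cis /= cosB sinB; ring.
Qed.

Lemma normc_sum (I : finType) (F : I -> R[i]) :
  normc (\sum_i F i) <= \sum_i normc (F i).
Proof.
elim/big_ind2: _ => [|x a y b xa yb|//]; first by rewrite Normc.normc0.
by rewrite (le_trans (le_normcD _ _))// lerD.
Qed.

Definition expsum (I : finType) (c : I -> R[i]) (theta : I -> R) t : R[i] :=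
  \sum_i c i * cis (theta i * t).

(** Sines enter as cosines with phase $-\pi/2$, the shape that [tpoly] accepts. *)
Lemma expsum_sqrE (I : finType) (c : I -> R[i]) theta t :
  normc (expsum c theta t) ^+ 2 =
  \sum_i \sum_j (cre (c i) (c j) * cos ((theta i - theta j) * t + 0) +
    cim (c i) (c j) * cos ((theta i - theta j) * t - pi / 2)).
Proof.
rewrite normc_sqr cre_sum; apply: eq_bigr => i _; apply: eq_bigr => j _.
by rewrite cre_mul_cis -mulrBl addr0 cosBpihalf.
Qed.

Lemma tpoly_sum (I : finType) (F : I -> R -> R) :
  (forall i, tpoly (F i)) -> tpoly (fun t => \sum_i F i t).
Proof.
move=> tF; rewrite -fct_sumE; elim/big_rec: _ => [|i f _ tf]; first exact: tpoly_cst.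
exact: tpoly_add.
Qed.

Lemma tpoly_expsum_sqr (I : finType) (c : I -> R[i]) theta :
  tpoly (fun t => normc (expsum c theta t) ^+ 2).
Proof.
under [X in tpoly X]eq_fun => t do rewrite expsum_sqrE.
by do 2 (apply: tpoly_sum => ?); apply: tpoly_add; exact: tpoly_cos.
Qed.

Lemma has_mean_sum (I : finType) (F : I -> R -> R) (l : I -> R) :
  (forall i, tpoly (F i)) -> (forall i, has_mean (F i) (l i)) ->
  has_mean (fun t => \sum_i F i t) (\sum_i l i).
Proof.
move=> tF mF; rewrite -fct_sumE.
suff [] : tpoly (\sum_i F i) /\ has_mean (\sum_i F i) (\sum_i l i) by [].
elim/big_rec2: _ => [|i g y _ [tg mg]].
  by split; [exact: tpoly_cst|exact: has_mean_cst].
by split; [exact: tpoly_add|apply: has_meanD => //; exact: tpoly_bmeas].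
Qed.

(** Only pairs of equal frequency survive averaging. Frequencies may repeat, as they do in the
    family of [k]-tuples produced by [expsum_exp]. *)
Lemma has_mean_expsum_sqr (I : finType) (c : I -> R[i]) theta :
  has_mean (fun t => normc (expsum c theta t) ^+ 2)
    (\sum_i \sum_(j | theta i == theta j) cre (c i) (c j)).
Proof.
under [X in has_mean X _]eq_fun => t do rewrite expsum_sqrE.
apply: has_mean_sum => i.
  by apply: tpoly_sum => j; apply: tpoly_add; exact: tpoly_cos.
rewrite [X in has_mean _ X]big_mkcond /=; apply: has_mean_sum => j.
  by apply: tpoly_add; exact: tpoly_cos.
have h phi d : has_mean (fun t => d * cos ((theta i - theta j) * t + phi))
    (d * (if theta i == theta j then cos phi else 0)).
  apply: has_meanZ; last by have := @has_mean_cos R (theta i - theta j) phi; rewrite subr_eq0.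
  by have := bmeas_cos 1 (theta i - theta j) phi; under eq_fun do rewrite mul1r.
have mD := has_meanD (bmeas_cos _ _ _) (bmeas_cos _ _ _)
  (h 0 (cre (c i) (c j))) (h (- (pi / 2)) (cim (c i) (c j))).
rewrite [X in has_mean _ X](_ : _ = cre (c i) (c j) * (if theta i == theta j then cos 0 else 0) +
  cim (c i) (c j) * (if theta i == theta j then cos (- (pi / 2)) else 0)); first exact: mD.
by rewrite cosN cos_pihalf cos0; case: ifP => _; rewrite ?mulr1 !mulr0 ?addr0.
Qed.

Lemma prod_cis (I : finType) (F : I -> R) : \prod_i cis (F i) = cis (\sum_i F i).
Proof. by symmetry; apply: (big_morph cis cisD cis0). Qed.

Lemma normc_prod (I : finType) (F : I -> R[i]) :
  normc (\prod_i F i) = \prod_i normc (F i).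
Proof.
elim/big_rec2: _ => [|i y z _ <-]; first exact: Normc.normc1.
exact: Normc.normcM.
Qed.

Lemma expsum_exp k (I : finType) (c : I -> R[i]) theta t :
  expsum c theta t ^+ k =
  expsum (fun x : {ffun 'I_k -> I} => \prod_i c (x i)) (fun x => \sum_i theta (x i)) t.
Proof.
rewrite -[X in _ ^+ X]card_ord -prodr_const.
under eq_bigl do rewrite inE.
rewrite /expsum bigA_distr_bigA /=; apply: eq_bigr => x _.
by rewrite big_split /= prod_cis mulr_suml.
Qed.

(** Grouping tuples by their sum $\mu$ turns this into $\sum_\mu|c_\mu|^2$, where $c_\mu$ is the
    coefficient of the [k]-th power at frequency $\mu$. *)
Definition evenform k (I : finType) (c : I -> R[i]) (theta : I -> R) : R :=
  \sum_(x : {ffun 'I_k -> I})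
    \sum_(y : {ffun 'I_k -> I} | \sum_i theta (x i) == \sum_i theta (y i))
      cre (\prod_i c (x i)) (\prod_i c (y i)).

Lemma has_mean_evenform k (I : finType) (c : I -> R[i]) theta :
  has_mean (fun t => normc (expsum c theta t) ^+ (2 * k)) (evenform k c theta).
Proof.
have -> : (fun t => normc (expsum c theta t) ^+ (2 * k)) =
    (fun t => normc (expsum c theta t ^+ k) ^+ 2).
  apply/funext => t; rewrite mulnC exprM; congr (_ ^+ 2).
  by elim: k => [|k ih]; rewrite ?expr0 ?Normc.normc1// !exprS Normc.normcM ih.
under [X in has_mean X _]eq_fun => t do rewrite expsum_exp.
exact: has_mean_expsum_sqr.
Qed.

End ExponentialSums.

(** * The norm of Dirichlet polynomials *)

(* [dirichlet_norm] is sealed behind an opaque proof, since conversion would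
   otherwise unfold the integrals to compare two norms. *)
Fact dnorm_spec (R : realType) : {N : (nat -> R) -> R -> {poly R[i]} -> R |
  forall lam p P, dirichlet_norm lam p P = N lam p P}.
Proof. by exists (@dirichlet_norm R). Qed.

Definition dnorm (R : realType) := sval (dnorm_spec R).

Lemma dnormE (R : realType) (lam : nat -> R) p P :
  dirichlet_norm lam p P = dnorm lam p P.
Proof. exact: (svalP (dnorm_spec R)). Qed.

Section DirichletNorm.
Context {R : realType}.
Local Open Scope complex_scope.
Local Notation normc := Normc.normc.
Variable lam : nat -> R.
Implicit Types (P Q : {poly R[i]}) (p q : R).

Lemma lineE P n t : (size P <= n)%N ->
  dirichlet_line lam P t = expsum (fun i : 'I_n => P`_i) (fun i => lam i) t.
Proof.
move=> Pn; rewrite /dirichlet_line /expsum /cis.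
rewrite (big_ord_widen_cond _ xpredT (fun i => P`_i * (cos (lam i * t) -i* sin (lam i * t))) Pn).
rewrite big_mkcond; apply: eq_bigr => i _; case: ifPn => //.
by rewrite -leqNgt => Pi; rewrite nth_default// mul0r.
Qed.

Lemma lineD P Q t :
  dirichlet_line lam (P + Q) t = dirichlet_line lam P t + dirichlet_line lam Q t.
Proof.
pose n := maxn (size P) (size Q).
rewrite !(@lineE _ n) ?leq_maxl ?leq_maxr ?size_polyD//.
by rewrite /expsum -big_split; apply: eq_bigr => i _; rewrite coefD mulrDl.
Qed.

Definition line_norm P t : R := normc (dirichlet_line lam P t).

Lemma line_norm_ge0 P t : 0 <= line_norm P t.
Proof. exact: normc_ge0. Qed.

Lemma line_normD P Q t : line_norm (P + Q) t <= line_norm P t + line_norm Q t.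
Proof. by rewrite /line_norm lineD; exact: le_normcD. Qed.

Lemma tpoly_line P : tpoly (fun t => line_norm P t ^+ 2).
Proof.
rewrite /line_norm; under [X in tpoly X]eq_fun => t do rewrite (@lineE P (size P))//.
exact: tpoly_expsum_sqr.
Qed.

Lemma line_norm_powE P p t : line_norm P t `^ p = (line_norm P t ^+ 2) `^ (p / 2).
Proof.
rewrite -powR_mulrn ?line_norm_ge0// -powRrM.
by congr (_ `^ _); field.
Qed.

(** Existence of the limit comes from writing $|P|^p$ as the $p/2$-th power of the trigonometric
    polynomial $|P|^2$. The shift [s] records translation invariance. *)
Fact pmean_spec : {M : R -> {poly R[i]} -> R | forall p P s, 0 < p ->
  has_mean (fun t => line_norm P (t + s) `^ p) (M p P)}.
Proof.
exists (fun p P => lim (avg (fun t => line_norm P t `^ p) T @[T --> +oo])) => p P s p0.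
have [l hl] : exists l, forall s, has_mean (fun t => line_norm P (t + s) `^ p) l.
  have [|l hl] := has_mean_powR (tpoly_line P) (a := p / 2) _ (fun t => sqr_ge0 _).
    by rewrite divr_gt0.
  by exists l => s'; under [X in has_mean X _]eq_fun => t do rewrite line_norm_powE; exact: hl.
rewrite (_ : lim _ = l)//; apply: (cvg_lim (@Rhausdorff R)).
have := hl 0; rewrite /has_mean.
by under [X in avg X]eq_fun => t do rewrite addr0.
Qed.

Definition pmean := sval pmean_spec.

Lemma has_pmean p P s : 0 < p -> has_mean (fun t => line_norm P (t + s) `^ p) (pmean p P).
Proof. exact: (svalP pmean_spec). Qed.

Lemma bmeas_pmean p P s : 0 <= p -> bmeas (fun t => line_norm P (t + s) `^ p).
Proof.
move=> p0; under eq_fun => t do rewrite line_norm_powE.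
apply: bmeas_powR => [||t]; [exact: (tpoly_bmeas (tpoly_shift s (tpoly_line P)))| |exact: sqr_ge0].
by rewrite divr_ge0.
Qed.

Lemma pmean_le1 p P q Q c s : 0 < p -> 0 < q ->
  (forall t, line_norm P (t + 0) `^ p <= c * line_norm Q (t + s) `^ q) ->
  pmean p P <= c * pmean q Q.
Proof.
move=> p0 q0 H; apply: (has_mean_le _ _ H).
- exact/bmeas_pmean/ltW.
- exact/bmeas_scale/bmeas_pmean/ltW.
- exact: has_pmean.
- by apply: has_meanZ; [exact/bmeas_pmean/ltW|exact: has_pmean].
Qed.

Lemma pmean_le2 p P q Q q' Q' c c' : 0 < p -> 0 < q -> 0 < q' ->
  (forall t, line_norm P (t + 0) `^ p <=
    c * line_norm Q (t + 0) `^ q + c' * line_norm Q' (t + 0) `^ q') ->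
  pmean p P <= c * pmean q Q + c' * pmean q' Q'.
Proof.
move=> p0 q0 q'0 H; apply: (has_mean_le _ _ H).
- exact/bmeas_pmean/ltW.
- by apply: bmeas_add; exact/bmeas_scale/bmeas_pmean/ltW.
- exact: has_pmean.
- apply: has_meanD; try exact/bmeas_scale/bmeas_pmean/ltW.
  + by apply: has_meanZ; [exact/bmeas_pmean/ltW|exact: has_pmean].
  + by apply: has_meanZ; [exact/bmeas_pmean/ltW|exact: has_pmean].
Qed.

Lemma pmean_le_cst p P q Q c c' : 0 < p -> 0 < q ->
  (forall t, line_norm P (t + 0) `^ p <= c * line_norm Q (t + 0) `^ q + c') ->
  pmean p P <= c * pmean q Q + c'.
Proof.
move=> p0 q0 H; apply: (has_mean_le _ _ H).
- exact/bmeas_pmean/ltW.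
- apply: bmeas_add; last exact: bmeas_cst.
  exact/bmeas_scale/bmeas_pmean/ltW.
- exact: has_pmean.
- apply: has_meanD; [exact/bmeas_scale/bmeas_pmean/ltW|exact: bmeas_cst| |exact: has_mean_cst].
  by apply: has_meanZ; [exact/bmeas_pmean/ltW|exact: has_pmean].
Qed.

Lemma pmean_ge0 p P : 0 < p -> 0 <= pmean p P.
Proof.
move=> p0; apply: (has_mean_le _ _ _ (@has_mean_cst R 0) (@has_pmean p P 0 p0)).
- exact: bmeas_cst.
- exact/bmeas_pmean/ltW.
- by move=> t; exact: powR_ge0.
Qed.

Local Notation N := (dnorm lam).

Lemma dnorm_pmeanE p P : 1 <= p -> N p P = pmean p P `^ p^-1.
Proof.
move=> p1; have p0 : 0 < p by exact: lt_le_trans p1.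
have ip0 : 0 < p^-1 by rewrite invr_gt0.
have ip1 : p^-1 <= 1 by rewrite invf_le1.
rewrite -dnormE; apply: (cvg_lim (@Rhausdorff R)).
have /cvgrPdist_le hm := @has_pmean p P 0 p0.
apply/cvgrPdist_le => e e0.
have ep0 : 0 < e `^ p by rewrite powR_gt0.
have := hm _ ep0; move=> h; near=> T.
have T0 : 0 < T by near: T; exact: nbhs_pinfty_gt.
have avg0 : 0 <= avg (fun t => line_norm P (t + 0) `^ p) T.
  rewrite /avg mulr_ge0//; first by rewrite invr_ge0 mulr_ge0// ltW.
  by apply: Rintegral_ge0 => t _; exact: powR_ge0.
have hT : `|pmean p P - avg (fun t => line_norm P (t + 0) `^ p) T| <= e `^ p by near: T.
have -> : (2 * T)^-1 * \int[lebesgue_measure]_(t in `[- T, T]) normc (dirichlet_line lam P t) `^ p =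
    avg (fun t => line_norm P (t + 0) `^ p) T.
  by under [X in avg X]eq_fun => t do rewrite addr0.
apply: (le_trans (powR_dist ip0 ip1 (pmean_ge0 P p0) avg0)).
rewrite [leRHS](_ : e = (e `^ p) `^ p^-1); last by rewrite -powRrM divff ?gt_eqF// powRr1// ltW.
by apply: ge0_ler_powR; rewrite ?nnegrE// ltW.
Unshelve. all: end_near. Qed.

Lemma norm_ge0 p P : 1 <= p -> 0 <= N p P.
Proof. by move=> p1; rewrite dnorm_pmeanE// powR_ge0. Qed.

Lemma pmeanE p P : 1 <= p -> pmean p P = N p P `^ p.
Proof.
move=> p1; have p0 : 0 < p by exact: lt_le_trans p1.
by rewrite dnorm_pmeanE// -powRrM mulVf ?gt_eqF// powRr1// pmean_ge0.
Qed.

Lemma norm_le_of_pmean p P c : 1 <= p -> 0 <= c -> pmean p P <= c `^ p -> N p P <= c.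
Proof.
move=> p1 c0 h; have p0 : 0 < p by exact: lt_le_trans p1.
have ip0 : 0 < p^-1 by rewrite invr_gt0.
have -> : c = (c `^ p) `^ p^-1 by rewrite -powRrM divff ?gt_eqF// powRr1// ltW.
rewrite dnorm_pmeanE//; apply: ge0_ler_powR => //; rewrite ?nnegrE ?pmean_ge0 ?powR_ge0//.
exact: ltW.
Qed.

Lemma norm_le_scale p P Q c s : 1 <= p -> 0 <= c ->
  (forall t, line_norm P t <= c * line_norm Q (t + s)) -> N p P <= c * N p Q.
Proof.
move=> p1 c0 H; have p0 : 0 < p by exact: lt_le_trans p1.
apply: norm_le_of_pmean => //; first by rewrite mulr_ge0// norm_ge0.
rewrite powRM ?norm_ge0// -pmeanE//; apply: (@pmean_le1 _ _ _ _ _ s) => // t.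
rewrite -powRM ?line_norm_ge0//; apply: ge0_ler_powR; rewrite ?addr0 ?nnegrE ?line_norm_ge0//.
  exact: ltW.
by rewrite mulr_ge0// line_norm_ge0.
Qed.

Lemma norm_le_bound p P B : 1 <= p -> (forall t, line_norm P t <= B) -> N p P <= B.
Proof.
move=> p1 H; have p0 : 0 < p by exact: lt_le_trans p1.
have B0 : 0 <= B by apply: le_trans (H 0); exact: line_norm_ge0.
apply: norm_le_of_pmean => //.
have := @pmean_le_cst p P p P 0 (B `^ p) p0 p0; rewrite mul0r add0r; apply => t.
rewrite mul0r add0r; apply: ge0_ler_powR; rewrite ?nnegrE ?line_norm_ge0//.
exact: ltW.
Qed.

Lemma powR_Bernoulli (r u : R) : 1 <= r -> 0 <= u -> u <= u `^ r / r + (1 - r^-1).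
Proof.
rewrite le_eqVlt => /predU1P[<- u0|r1 u0].
  by rewrite powRr1// invr1 mulr1 subrr addr0.
have r0 : 0 < r by exact: lt_trans r1.
have ir1 : 0 < 1 - r^-1 by rewrite subr_gt0 invf_lt1.
have := @conjugate_powR R u 1 r (1 - r^-1)^-1 u0 ler01 r0.
by rewrite invr_gt0 invrK subrKC powR1 mulr1 mul1r; apply.
Qed.

(** The pointwise Young inequality $x^p\le c^p\left(\frac pq(x/c)^q+1-\frac pq\right)$, with [c]
    just above the [q]-norm, averages to at most $c^p$. The added [e] keeps [c] positive. *)
Lemma norm_mono p q P : 1 <= p -> p <= q -> N p P <= N q P.
Proof.
move=> p1 pq; have p0 : 0 < p by exact: lt_le_trans p1.
have q1 : 1 <= q by exact: le_trans pq.
have q0 : 0 < q by exact: lt_le_trans q1.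
apply/ler_addgt0Pr => e e0.
set c := N q P + e; have c0 : 0 < c by rewrite ltr_wpDl// norm_ge0.
apply: norm_le_of_pmean => //; first exact: ltW.
have r1 : 1 <= q / p by rewrite ler_pdivlMr// mul1r.
have cp0 : 0 < c `^ p by rewrite powR_gt0.
have cq0 : 0 < c `^ q by rewrite powR_gt0.
have key : pmean p P <= (c `^ p / c `^ q * (p / q)) * pmean q P + c `^ p * (1 - p / q).
  apply: pmean_le_cst => // t; set x := line_norm P (t + 0).
  have x0 : 0 <= x by exact: line_norm_ge0.
  have := @powR_Bernoulli (q / p) (x `^ p / c `^ p) r1 _.
  rewrite divr_ge0 ?powR_ge0// => /(_ isT).
  rewrite powRM ?powR_ge0 ?invr_ge0 ?powR_ge0// -!powRN -!powRrM.
  have -> : p * (q / p) = q by field; rewrite gt_eqF.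
  have -> : - p * (q / p) = - q by field; rewrite gt_eqF.
  rewrite !powRN invf_div -(ler_pM2l cp0) => h; apply: le_trans (le_trans h _).
    by rewrite mulrC divfK// gt_eqF.
  rewrite le_eqVlt; apply/orP; left; apply/eqP; field.
  by rewrite !gt_eqF.
apply: (le_trans key).
rewrite [leRHS](_ : _ = c `^ p / c `^ q * (p / q) * c `^ q + c `^ p * (1 - p / q)); last first.
  by field; rewrite !gt_eqF.
rewrite lerD2r; apply: ler_wpM2l.
  by rewrite mulr_ge0// ?divr_ge0// ltW.
by rewrite pmeanE//; apply: ge0_ler_powR; rewrite ?nnegrE ?norm_ge0// ?ltW// ltrDl.
Qed.

(** Convexity of $u^p$ at the points $x/s$ and $y/(1-s)$ with weights $s$ and $1-s$. *)
Lemma powR_convexD (p x y s : R) : 1 <= p -> 0 <= x -> 0 <= y -> 0 < s -> s < 1 ->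
  (x + y) `^ p <= s / s `^ p * x `^ p + (1 - s) / (1 - s) `^ p * y `^ p.
Proof.
move=> p1 x0 y0 s0 s1.
have s1' : 0 < 1 - s by rewrite subr_gt0.
have ht : 0 <= s <= 1 by rewrite !ltW.
have := @convex_powR R p p1 (Itv01 (ltW s0) (ltW s1)) (x / s) (y / (1 - s)).
rewrite !inE/= !in_itv/= !andbT !divr_ge0 ?(ltW s0) ?(ltW s1')// => /(_ isT isT).
set u := conv _ _ _; have -> : u = s * (x / s) + (1 - s) * (y / (1 - s)) by [].
rewrite convRE /= /unstable.onem.
have -> : s * (x / s) + (1 - s) * (y / (1 - s)) = x + y by field; rewrite !gt_eqF.
move=> h; apply: (le_trans h); rewrite le_eqVlt; apply/orP; left; apply/eqP.
rewrite !powRM ?invr_ge0 ?(ltW s0) ?(ltW s1')//.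
have iE v : 0 < v -> v^-1 `^ p = (v `^ p)^-1.
  by move=> v0; rewrite -(powR_inv1 (ltW v0)) -powRrM mulN1r powRN.
by rewrite !iE//; ring.
Qed.

(** Minkowski's inequality follows by averaging [powR_convexD] with weights proportional to the two
    norms; the terms [e / 2] keep both weights positive. *)
Lemma normD p P Q : 1 <= p -> N p (P + Q) <= N p P + N p Q.
Proof.
move=> p1; have p0 : 0 < p by exact: lt_le_trans p1.
apply/ler_addgt0Pr => e e0.
pose a := N p P + e / 2; pose b := N p Q + e / 2.
have e20 : 0 < e / 2 by rewrite divr_gt0.
have a0 : 0 < a by rewrite ltr_wpDl// norm_ge0.
have b0 : 0 < b by rewrite ltr_wpDl// norm_ge0.
have -> : N p P + N p Q + e = a + b.
  have h (x y z : R) : x + y + z = x + z / 2 + (y + z / 2) by field.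
  exact: h.
apply: norm_le_of_pmean => //; first by rewrite ltW// addr_gt0.
have ab0 : 0 < a + b by rewrite addr_gt0.
pose s := a / (a + b).
have s0 : 0 < s by rewrite divr_gt0.
have s1 : s < 1 by rewrite ltr_pdivrMr// mul1r ltrDl.
have s1E : 1 - s = b / (a + b) by rewrite /s; field; rewrite gt_eqF.
have s10 : 0 < 1 - s by rewrite subr_gt0.
have H := @pmean_le2 p (P + Q) p P p Q (s / s `^ p) ((1 - s) / (1 - s) `^ p) p0 p0 p0.
apply: (le_trans (H _)).
  move=> t; apply: le_trans (powR_convexD p1 (line_norm_ge0 _ _) (line_norm_ge0 _ _) s0 s1).
  apply: ge0_ler_powR; rewrite ?nnegrE ?addr_ge0 ?line_norm_ge0 ?line_normD//.
  exact: ltW.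
have hE u : 0 < u -> u = u / (a + b) * (a + b) by move=> u0; rewrite divfK// gt_eqF.
have aE : a `^ p = s `^ p * (a + b) `^ p by rewrite {1}(hE _ a0) powRM// ltW.
have bE : b `^ p = (1 - s) `^ p * (a + b) `^ p by rewrite {1}(hE _ b0) -s1E powRM// ltW.
have sp0 : s `^ p != 0 by rewrite gt_eqF// powR_gt0.
have sp10 : (1 - s) `^ p != 0 by rewrite gt_eqF// powR_gt0.
have -> : (a + b) `^ p = s / s `^ p * a `^ p + (1 - s) / (1 - s) `^ p * b `^ p.
  have hAB (A B C : R) : A != 0 -> B != 0 -> C = s / A * (A * C) + (1 - s) / B * (B * C).
    by move=> A0 B0; field; rewrite A0 B0.
  by rewrite aE bE; exact: hAB.
have le_pow X c : 0 < c -> N p X + e / 2 = c -> pmean p X <= c `^ p.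
  move=> c0 cE; rewrite pmeanE//; apply: ge0_ler_powR; rewrite ?nnegrE ?norm_ge0// ?ltW//.
  by rewrite -cE ltrDl.
apply: lerD; apply: ler_wpM2l.
- by rewrite divr_ge0 ?powR_ge0// ltW.
- exact: (le_pow _ _ a0 erefl).
- by rewrite divr_ge0 ?powR_ge0// ltW.
- exact: (le_pow _ _ b0 erefl).
Qed.

Lemma pmean_natE p (m : nat) P : p = m%:R -> (0 < m)%N -> pmean p P = N p P ^+ m.
Proof.
move=> pm m0; have p1 : 1 <= p by rewrite pm ler1n.
by rewrite pmeanE// {2}pm powR_mulrn// norm_ge0.
Qed.

(** A form of $\|g\|_2^3\le\|g\|_1\|g\|_4^2$ that is linear in the means; optimising [s] recovers
    it. It averages $3u^2\le2u+u^4$ at $u=x/s$, which is $u(u-1)^2(u+2)\ge0$. *)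
Lemma norm_interpolation_of p1 p2 p4 P s : p1 = 1 -> p2 = 2 -> p4 = 4 -> 0 < s ->
  3 * N p2 P ^+ 2 <= 2 * s * N p1 P + s ^- 2 * N p4 P ^+ 4.
Proof.
move=> E1 E2 E4 s0.
have p10 : 0 < p1 by rewrite E1.
have p20 : 0 < p2 by rewrite E2.
have p40 : 0 < p4 by rewrite E4.
have := @pmean_le2 p2 P p1 P p4 P (2 * s / 3) (s ^- 2 / 3) p20 p10 p40.
rewrite (pmean_natE (m := 2) _ E2)// (pmean_natE (m := 4) _ E4)// (pmean_natE (m := 1) _ E1)// expr1.
set A := N p2 P; set B := N p1 P; set C := N p4 P.
move=> h.
have {h} : A ^+ 2 <= 2 * s / 3 * B + s ^- 2 / 3 * C ^+ 4.
  apply: h => t; set x := line_norm P (t + 0).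
  have x0 : 0 <= x by exact: line_norm_ge0.
  have xE p (m : nat) : p = m%:R -> x `^ p = x ^+ m by move=> ->; rewrite powR_mulrn.
  rewrite (xE p2 2%N)// (xE p1 1%N)// (xE p4 4%N)// expr1.
  have -> : x = s * (x / s) by field; rewrite gt_eqF.
  have : 0 <= x / s by rewrite divr_ge0// ltW.
  set u := x / s => u0.
  rewrite -subr_ge0.
  have -> : 2 * s / 3 * (s * u) + s ^- 2 / 3 * (s * u) ^+ 4 - (s * u) ^+ 2 =
      s ^+ 2 / 3 * (u * (u - 1) ^+ 2 * (u + 2)) by field; rewrite gt_eqF.
  apply: mulr_ge0; first by rewrite divr_ge0// sqr_ge0.
  by apply: mulr_ge0; [rewrite mulr_ge0// sqr_ge0|rewrite addr_ge0].
have h3 (a b c : R) : a <= 2 * s / 3 * b + s ^- 2 / 3 * c -> 3 * a <= 2 * s * b + s ^- 2 * c.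
  rewrite -(ler_pM2l (ltr0n _ 3)) => /le_trans; apply; rewrite le_eqVlt; apply/orP; left; apply/eqP.
  by field; rewrite gt_eqF.
exact: h3.
Qed.

Lemma norm_interpolation P s : 0 < s ->
  3 * N 2 P ^+ 2 <= 2 * s * N 1 P + s ^- 2 * N 4 P ^+ 4.
Proof. exact: norm_interpolation_of. Qed.

Lemma norm_even k P n : (0 < k)%N -> (size P <= n)%N ->
  N (2 * k)%:R P ^+ (2 * k) = evenform k (fun i : 'I_n => P`_i) (fun i => lam i).
Proof.
move=> k0 Pn; have k1 : 1 <= (2 * k)%:R :> R by rewrite ler1n muln_gt0.
rewrite -powR_mulrn ?norm_ge0// -pmeanE//.
have := @has_mean_evenform R k _ (fun i : 'I_n => P`_i) (fun i => lam i).
apply: has_mean_uniq.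
have := @has_pmean _ P 0 (lt_le_trans ltr01 k1); rewrite /has_mean.
under [X in avg X @ _ --> _ -> _]eq_fun => t do
  rewrite addr0 powR_mulrn ?line_norm_ge0// /line_norm (lineE _ Pn).
by [].
Qed.

End DirichletNorm.

(** * Multipliers *)

Section Multipliers.
Context {R : realType}.
Local Open Scope complex_scope.
Local Notation normc := Normc.normc.
Variable lam : nat -> R.
Implicit Types (P Q : {poly R[i]}) (p q : R) (w v : nat -> R[i]).
Local Notation N := (dnorm lam).

Definition mulc w P : {poly R[i]} := \poly_(n < size P) (P`_n * w n).
Definition mulw (w : nat -> R) P := mulc (fun n => (w n)%:C) P.

Lemma coef_mulc w P n : (mulc w P)`_n = P`_n * w n.
Proof.
by rewrite coef_poly; case: ltnP => // Pn; rewrite nth_default// mul0r.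
Qed.

Lemma coef_mulw (w : nat -> R) P n : (mulw w P)`_n = P`_n * (w n)%:C.
Proof. exact: coef_mulc. Qed.

Lemma size_mulc w P : (size (mulc w P) <= size P)%N.
Proof. exact: size_poly. Qed.

Lemma mulcB w P Q : mulc w (P - Q) = mulc w P - mulc w Q.
Proof. by apply/polyP => n; rewrite coefB !coef_mulc coefB mulrBl. Qed.

Lemma mulw_mulw (w v : nat -> R) P : mulw w (mulw v P) = mulw (fun n => v n * w n) P.
Proof. by apply/polyP => n; rewrite !coef_mulw rmorphM mulrA. Qed.

Lemma mulw_id P : mulw (fun=> 1) P = P.
Proof. by apply/polyP => n; rewrite coef_mulw mulr1. Qed.

Lemma mulw_eq (w v : nat -> R) P : (forall n, (n < size P)%N -> w n = v n) -> mulw w P = mulw v P.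
Proof.
move=> wv; apply/polyP => n; rewrite !coef_mulw; case: (ltnP n (size P)) => [/wv->//|Pn].
by rewrite nth_default// !mul0r.
Qed.

Lemma line_mulc_cis (a s t : R) P :
  dirichlet_line lam (mulc (fun n => a%:C * cis (lam n * s)) P) t =
  a%:C * dirichlet_line lam P (t + s).
Proof.
rewrite (lineE _ _ (size_mulc _ _)) (lineE _ _ (leqnn _)) /expsum mulr_sumr.
apply: eq_bigr => i _; rewrite coef_mulc [lam i * (t + s)]mulrDr cisD.
by ring.
Qed.

Lemma norm_mulc_cis p (a s : R) (z : R[i]) P : 1 <= p -> normc z = 1 -> 0 <= a ->
  N p (mulc (fun n => z * (a%:C * cis (lam n * s))) P) <= a * N p P.
Proof.
move=> p1 z1 a0; apply: (@norm_le_scale _ _ _ _ _ _ s) => // t.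
have -> : mulc (fun n => z * (a%:C * cis (lam n * s))) P =
    z *: mulc (fun n => a%:C * cis (lam n * s)) P.
  by apply/polyP => n; rewrite coefZ !coef_mulc mulrCA.
rewrite /line_norm.
have -> Q : dirichlet_line lam (z *: Q) t = z * dirichlet_line lam Q t.
  rewrite (lineE _ _ (size_scale_leq z Q)) (lineE _ _ (leqnn _)) /expsum mulr_sumr.
  by apply: eq_bigr => i _; rewrite coefZ mulrA.
by rewrite line_mulc_cis !Normc.normcM z1 mul1r normc_real ger0_norm.
Qed.

Lemma norm_mulw_cos p (h c : R) P : 1 <= p ->
  N p (mulw (fun n => cos (h * (lam n - c))) P) <= N p P.
Proof.
move=> p1.
have -> : mulw (fun n => cos (h * (lam n - c))) P =
    mulc (fun n => cis (- (h * c)) * ((2^-1)%:C * cis (lam n * h))) P +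
    mulc (fun n => cis (h * c) * ((2^-1)%:C * cis (lam n * (- h)))) P.
  apply/polyP => n; rewrite coefD coef_mulw !coef_mulc -mulrDr; congr (_ * _).
  rewrite !(mulrCA (cis _)) -!cisD -mulrDr.
  have -> : - (h * c) + lam n * h = h * (lam n - c) by ring.
  have -> : h * c + lam n * - h = - (h * (lam n - c)) by ring.
  rewrite /cis cosN sinN opprK; apply/eqP; rewrite eq_complex /=.
  by apply/andP; split; apply/eqP; field.
apply: (le_trans (normD _ _ _ p1)); rewrite [leRHS](_ : _ = 2^-1 * N p P + 2^-1 * N p P); last by field.
by apply: lerD; apply: norm_mulc_cis; rewrite // ?normc_cis ?invr_ge0.
Qed.

Lemma norm_mulw_cosX p (h c : R) m P : 1 <= p ->
  N p (mulw (fun n => cos (h * (lam n - c)) ^+ m) P) <= N p P.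
Proof.
move=> p1; elim: m => [|m ih].
  by rewrite (@mulw_eq _ (fun=> 1)) ?mulw_id// => n _; rewrite expr0.
have := norm_mulw_cos h c (mulw (fun n => cos (h * (lam n - c)) ^+ m) P) p1.
rewrite mulw_mulw => /le_trans; move=> /(_ _ ih).
by under eq_fun do rewrite -exprSr.
Qed.

(** * Gaussian cutoffs from powers of cosines *)

Lemma sin_le_id (x : R) : 0 <= x -> sin x <= x.
Proof.
rewrite le_eqVlt => /predU1P[<-|x0]; first by rewrite sin0.
have [|c _] := @MVT R sin cos 0 x x0 (fun y _ => is_derive_sin y).
  by apply: continuous_subspaceT; exact: continuous_sin.
rewrite sin0 !subr0 => ->; rewrite -[leRHS]mul1r; apply: ler_wpM2r; first exact: ltW.
exact: cos_le1.
Qed.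

Lemma cos_half (x : R) : cos x = 1 - 2 * sin (x / 2) ^+ 2.
Proof.
have {1}-> : x = (x / 2) *+ 2 by rewrite mulr2n -splitr.
by rewrite cos_mulr2n cos2sin2 mulr2n; ring.
Qed.

Lemma cos_ge (x : R) : 1 - x ^+ 2 / 2 <= cos x.
Proof.
wlog x0 : x / 0 <= x => [hw|].
  have [/hw//|/ltW x0] := leP 0 x.
  by rewrite -cosN -sqrrN; apply: hw; rewrite oppr_ge0.
rewrite cos_half lerD2l lerN2.
have h : sin (x / 2) ^+ 2 <= (x / 2) ^+ 2.
  rewrite -[leLHS]real_normK ?num_real// lerXn2r ?nnegrE ?normr_ge0 ?divr_ge0//.
  rewrite ler_norml sin_le_id ?divr_ge0// andbT.
  have [x2|x2] := leP (x / 2) 2.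
    apply: (@le_trans _ _ 0); first by rewrite oppr_le0 divr_ge0.
    apply: sin_ge0_pi; rewrite divr_ge0//=; apply: le_trans x2 _; exact: pi_ge2.
  by apply: le_trans (sin_geN1 _); rewrite lerN2; lra.
by move: h; rewrite exprMn; lra.
Qed.

(** By the mean value theorem $\sin(x/2)$ is $x/2$ times a cosine of at least $7/8$. As
    $2(7/8)^2\ge1$, this gives $\cos x=1-2\sin^2(x/2)\le1-x^2/4$. *)
Lemma cos_le_expR (x : R) : `|x| <= 1 -> cos x <= expR (- (x ^+ 2 / 4)).
Proof.
wlog x0 : x / 0 <= x => [hw|].
  have [/hw//|/ltW x0] := leP 0 x.
  by rewrite -cosN -sqrrN -normrN; apply: hw; rewrite oppr_ge0.
rewrite ger0_norm// => x1.
apply: le_trans (expR_ge1Dx _); rewrite cos_half lerD2l lerN2.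
move: x0; rewrite le_eqVlt => /predU1P[<-|x0].
  by rewrite expr0n !mul0r mulr_ge0// sqr_ge0.
set y := x / 2; have y0 : 0 < y by rewrite divr_gt0.
have [|c] := @MVT R sin cos 0 y y0 (fun z _ => is_derive_sin z).
  by apply: continuous_subspaceT; exact: continuous_sin.
rewrite in_itv/= => /andP[c0 cy]; rewrite sin0 !subr0 => sE.
have y12 : y <= 1 / 2 by rewrite /y ler_pM2r// invr_gt0.
have ch : 7 / 8 <= cos c by apply: le_trans (cos_ge c); nra.
have -> : x = 2 * y by rewrite /y; field.
have c2 : 1 <= 2 * cos c ^+ 2 by nra.
have -> : (2 * y) ^+ 2 / 4 = 1 * y ^+ 2 by field.
have E : 2 * (cos c * y) ^+ 2 = (2 * cos c ^+ 2) * y ^+ 2 by ring.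
by rewrite sE E; apply: ler_wpM2r => //; exact: sqr_ge0.
Qed.

Lemma Bernoulli_exprn (a : R) n : 0 <= a <= 1 -> 1 - n%:R * a <= (1 - a) ^+ n.
Proof.
move=> /andP[a0 a1]; elim: n => [|n ih]; first by rewrite mul0r subr0 expr0.
rewrite exprS; apply: le_trans (ler_wpM2l _ ih); last by rewrite subr_ge0.
have := ler0n R n; rewrite -natr1; nra.
Qed.

(* Powers of cosines approximate a Gaussian on a bounded range of frequencies,
   and multiplying the coefficients by a cosine averages two translates. *)
Lemma gaussian_multiplier (L c d : R) : 0 <= L -> 0 < d ->
  exists w : R -> R,
    (forall p P, 1 <= p -> N p (mulw (w \o lam) P) <= N p P) /\
    (forall x, `|x - c| <= L -> [/\ 0 <= w x, 1 - d * (x - c) ^+ 2 <= w x &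
      w x <= expR (- (d / 2 * (x - c) ^+ 2))]).
Proof.
move=> L0 d0.
(* With $h^2=d/n$, the size of [n] keeps $|h(x-c)|\le1$ on the whole range, where both cosine bounds
   apply, while the [2 * n] factors accumulate to bounds in which neither [n] nor [L] appears. *)
pose n := (Num.truncn (d * L ^+ 2)).+1.
have n0 : 0 < n%:R :> R by rewrite ltr0n.
have dLn : d * L ^+ 2 <= n%:R by apply/ltW; rewrite /n truncnS_gt.
pose h := Num.sqrt (d / n%:R).
have h2 : h ^+ 2 = d / n%:R by rewrite sqr_sqrtr// divr_ge0// ltW.
exists (fun x => cos (h * (x - c)) ^+ (2 * n)); split.
  by move=> p P p1; exact: norm_mulw_cosX.
move=> x xL; set y := h * (x - c).
have y2E : y ^+ 2 = d / n%:R * (x - c) ^+ 2 by rewrite exprMn h2.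
have y21 : y ^+ 2 <= 1.
  rewrite y2E mulrAC ler_pdivrMr// mul1r (le_trans _ dLn)// ler_pM2l//.
  by rewrite -[leLHS]real_normK ?num_real// lerXn2r ?nnegrE.
have y1 : `|y| <= 1 by rewrite -(@expr_le1 _ 2)// real_normK ?num_real.
have cy0 : 0 <= cos y by apply: le_trans (cos_ge y); lra.
split; first exact: exprn_ge0.
  apply: (@le_trans _ _ ((1 - y ^+ 2 / 2) ^+ (2 * n))); last first.
    by rewrite lerXn2r// ?nnegrE ?subr_ge0; [lra|exact: cos_ge].
  apply: (@le_trans _ _ (1 - (2 * n)%:R * (y ^+ 2 / 2))); last first.
    by apply: Bernoulli_exprn; rewrite divr_ge0 ?sqr_ge0//=; lra.
  rewrite natrM y2E le_eqVlt; apply/orP; left; apply/eqP; field.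
  by rewrite gt_eqF.
apply: (@le_trans _ _ (expR (- (y ^+ 2 / 4)) ^+ (2 * n))).
  rewrite lerXn2r ?nnegrE ?expR_ge0//; exact: cos_le_expR.
rewrite -expRM_natl y2E natrM le_eqVlt; apply/orP; left; apply/eqP; congr expR.
by field; rewrite gt_eqF.
Qed.

(** * Norms compared through coefficients *)

Lemma norm_majorant k P Q (b : nat -> R) : (0 < k)%N ->
  (forall n, normc P`_n <= b n) -> (forall n, Q`_n = (b n)%:C) ->
  N (2 * k)%:R P <= N (2 * k)%:R Q.
Proof.
move=> k0 Pb Qb.
have k1 : 1 <= (2 * k)%:R :> R by rewrite ler1n muln_gt0.
rewrite -(@ler_pXn2r _ (2 * k)) ?muln_gt0 ?nnegrE ?norm_ge0//.
pose n := maxn (size P) (size Q).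
rewrite !(@norm_even _ _ _ _ n) ?leq_maxl ?leq_maxr//.
have b0 i : 0 <= b i by exact: le_trans (normc_ge0 _) (Pb i).
apply: ler_sum => x _; apply: ler_sum => y _.
apply: (le_trans (ler_norm _)); apply: (le_trans (cre_le _ _)).
have prodE (z : {ffun 'I_k -> 'I_n}) : \prod_i Q`_(z i) = (\prod_i b (z i))%:C.
  by rewrite rmorph_prod; apply: eq_bigr => i _; rewrite Qb.
have le_prod (z : {ffun 'I_k -> 'I_n}) : normc (\prod_i P`_(z i)) <= \prod_i b (z i).
  by rewrite normc_prod; apply: ler_prod => i _; rewrite normc_ge0 Pb.
by rewrite !prodE cre_real; apply: ler_pM; rewrite ?normc_ge0.
Qed.

Lemma norm_scale p (a : R) P : 1 <= p -> 0 <= a -> N p (mulw (fun=> a) P) <= a * N p P.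
Proof.
move=> p1 a0; have := @norm_mulc_cis p a 0 1 P p1 (Normc.normc1 R) a0.
by under eq_fun do rewrite mul1r mulr0 cis0 mulr1.
Qed.

Lemma norm_le_coef p P n : 1 <= p -> (size P <= n)%N -> N p P <= \sum_(i < n) normc P`_i.
Proof.
move=> p1 Pn; apply: norm_le_bound => // t; rewrite /line_norm (lineE _ _ Pn).
apply: (le_trans (normc_sum _)); apply: ler_sum => i _.
by rewrite Normc.normcM normc_cis mulr1.
Qed.

Lemma norm0 p : 1 <= p -> N p 0 = 0.
Proof.
move=> p1; apply/eqP; rewrite eq_le norm_ge0// andbT.
by have := @norm_le_coef p 0 0 p1; rewrite big_ord0 size_poly0; apply.
Qed.

Lemma normN p P : 1 <= p -> N p (- P) = N p P.
Proof.
have le_N Q : 1 <= p -> N p (- Q) <= N p Q.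
  move=> p1; rewrite -[leRHS]mul1r; apply: (@norm_le_scale _ _ _ _ _ _ 0) => // t.
  rewrite addr0 mul1r /line_norm.
  have := lineD lam (- Q) Q t; rewrite addNr.
  have -> : dirichlet_line lam 0 t = 0 by rewrite /dirichlet_line size_poly0 big_ord0.
  by move/eqP; rewrite eq_sym addr_eq0 => /eqP ->; rewrite normcN.
by move=> p1; apply/eqP; rewrite eq_le le_N//= -{1}[P]opprK le_N.
Qed.

Lemma norm_sum p (I : Type) (r : seq I) (F : I -> {poly R[i]}) : 1 <= p ->
  N p (\sum_(i <- r) F i) <= \sum_(i <- r) N p (F i).
Proof.
move=> p1; elim/big_ind2: _ => [|x a y b xa yb|//]; first by rewrite norm0.
by rewrite (le_trans (normD _ _ _ p1))// lerD.
Qed.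

Lemma norm_dist p P Q : 1 <= p -> `|N p P - N p Q| <= N p (P - Q).
Proof.
move=> p1; have h X Y : N p X - N p Y <= N p (X - Y).
  by rewrite lerBlDr -{1}[X](subrK Y) normD.
have hQ := h Q P; rewrite -(normN (Q - P) p1) opprB in hQ.
by rewrite ler_norml h andbT lerNl opprB.
Qed.

Hypothesis lam_inj : injective lam.

Lemma norm2_sqr P n : (size P <= n)%N -> N 2 P ^+ 2 = \sum_(i < n) normc P`_i ^+ 2.
Proof.
move=> Pn; rewrite -(@pmean_natE _ _ 2 2)//.
have := @has_mean_expsum_sqr R _ (fun i : 'I_n => P`_i) (fun i => lam i).
rewrite (eq_bigr (fun i : 'I_n => normc P`_i ^+ 2)); last first.
  move=> i _; rewrite (big_pred1 i) ?normc_sqr// => j /=.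
  by rewrite (inj_eq lam_inj) eq_sym.
apply: has_mean_uniq.
have := @has_pmean R lam 2 P 0 (ltr0n _ 2); rewrite /has_mean.
under [X in avg X @ _ --> _ -> _]eq_fun => t do
  rewrite addr0 powR_mulrn ?line_norm_ge0// /line_norm (lineE _ _ Pn).
by [].
Qed.

Lemma norm2_le P Q : (forall n, normc P`_n <= normc Q`_n) -> N 2 P <= N 2 Q.
Proof.
move=> PQ; rewrite -(@ler_pXn2r _ 2) ?nnegrE ?norm_ge0 ?ler1n//.
rewrite !(@norm2_sqr _ (maxn (size P) (size Q))) ?leq_maxl ?leq_maxr//.
by apply: ler_sum => i _; rewrite lerXn2r ?nnegrE ?normc_ge0.
Qed.

Lemma norm2_mulw_le (w : nat -> R) B P : 0 <= B ->
  (forall n, (n < size P)%N -> `|w n| <= B) -> N 2 (mulw w P) <= B * N 2 P.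
Proof.
move=> B0 wB; apply: (@le_trans _ _ (N 2 (mulw (fun=> B) P))); last by apply: norm_scale; rewrite ?ler1n.
apply: norm2_le => n; rewrite !coef_mulw !Normc.normcM !normc_real.
case: (ltnP n (size P)) => nP; last by rewrite nth_default// Normc.normc0 !mul0r.
by rewrite ler_wpM2l ?normc_ge0// [leRHS]ger0_norm ?wB.
Qed.

Lemma coef_le_norm2 P n : normc P`_n <= N 2 P.
Proof.
rewrite -(@ler_pXn2r _ 2) ?nnegrE ?norm_ge0 ?normc_ge0 ?ler1n//.
rewrite (@norm2_sqr P (maxn n.+1 (size P))) ?leq_maxr//.
have nm : (n < maxn n.+1 (size P))%N by rewrite leq_maxl.
rewrite (bigD1 (Ordinal nm))//= lerDl; apply: sumr_ge0 => i _; exact: sqr_ge0.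
Qed.

End Multipliers.

(** * From blocks to smoothing *)

Section BlockBounds.
Context {R : realType}.
Local Open Scope complex_scope.
Local Notation normc := Normc.normc.
Variable lam : nat -> R.
Hypothesis hlam : frequency lam.
Implicit Types (P Q : {poly R[i]}) (p q sigma : R).
Local Notation N := (dnorm lam).

Definition tau sigma P := mulw (fun n => expR (- (lam n * sigma))) P.

Definition inblock (j : nat) P :=
  forall n, P`_n != 0 -> j%:R <= lam n < j.+1%:R.

Definition block_bound := forall (k : nat) (e : R), (0 < k)%N -> 0 < e ->
  exists2 A, 0 < A & forall j P, inblock j P ->
    N (2 * k)%:R P <= A * expR (e * j%:R) * N 2 P.

Definition block n := Num.truncn (lam n).

Lemma freq_ge0 n : 0 <= lam n.
Proof. by case: hlam. Qed.

Lemma freq_le m n : (m <= n)%N -> lam m <= lam n.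
Proof.
rewrite leq_eqVlt => /predU1P[->//|mn]; case: hlam => h _ _; exact/ltW/h.
Qed.

Lemma freq_inj : injective lam.
Proof.
case: hlam => h _ _ m n mn.
by have [/h|/h|//] := ltngtP m n; rewrite mn ltxx.
Qed.

Lemma blockP n : (block n)%:R <= lam n < (block n).+1%:R.
Proof. exact/truncn_itv/freq_ge0. Qed.

Lemma block_eq n j : j%:R <= lam n < j.+1%:R -> block n = j.
Proof. exact: truncn_def. Qed.

Lemma block_le m n : (m <= n)%N -> (block m <= block n)%N.
Proof. by move=> mn; apply: le_truncn; exact: freq_le. Qed.

Lemma expR_geometric_sum (a : R) J : 0 < a ->
  \sum_(j < J) expR (- (a * j%:R)) <= (1 - expR (- a))^-1.
Proof.
move=> a0; have r1 : expR (- a) < 1 by rewrite expR_lt1 oppr_lt0.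
have r0 : 0 < 1 - expR (- a) by rewrite subr_gt0.
rewrite -[leRHS]mul1r ler_pdivlMr//.
have -> : (\sum_(j < J) expR (- (a * j%:R))) * (1 - expR (- a)) = 1 - expR (- a) ^+ J.
  elim: J => [|J ih]; first by rewrite big_ord0 mul0r expr0 subrr.
  rewrite big_ord_recr /= mulrDl ih exprSr.
  have -> : expR (- (a * J%:R)) = expR (- a) ^+ J by rewrite -expRM_natr mulNr.
  by ring.
by rewrite gerDl oppr_le0 exprn_ge0// expR_ge0.
Qed.

Definition block_part j P := mulw (fun n => (block n == j)%:R) P.

Lemma block_part_sum P J : (forall n, (n < size P)%N -> (block n < J)%N) ->
  \sum_(j < J) block_part j P = P.
Proof.
move=> PJ; apply/polyP => n; rewrite coef_sum.
under eq_bigr do rewrite coef_mulw.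
have [nP|Pn] := ltnP n (size P); last first.
  by rewrite nth_default// big1// => j _; rewrite mul0r.
rewrite (bigD1 (Ordinal (PJ n nP)))//= eqxx mulr1 big1 ?addr0// => j jn.
rewrite (_ : (block n == j) = false) ?mulr0//.
by apply/eqP => nj; move/eqP: jn; apply; exact: val_inj.
Qed.

Lemma inblock_mulw j (w : nat -> R) P : inblock j P -> inblock j (mulw w P).
Proof.
move=> jP n; rewrite coef_mulw => H; apply: jP; apply: contraNneq H => ->.
by rewrite mul0r.
Qed.

Lemma inblock_block_part j P : inblock j (block_part j P).
Proof.
move=> n; rewrite coef_mulw; case: (eqVneq (block n) j) => [<- _|_]; first exact: blockP.
by rewrite mulr0 eqxx.
Qed.

Lemma tau_block_norm2 j sigma P : 0 <= sigma -> inblock j P ->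
  N 2 (tau sigma P) <= expR (- (sigma * j%:R)) * N 2 P.
Proof.
move=> s0 jP.
have -> : tau sigma P = mulw (fun n => if block n == j then expR (- (lam n * sigma)) else 0) P.
  apply/polyP => n; rewrite !coef_mulw; case: eqP => // bn.
  have [->|/jP] := eqVneq P`_n 0; first by rewrite !mul0r.
  by move/block_eq.
apply: norm2_mulw_le; [exact: freq_inj|exact: expR_ge0|move=> n _].
case: eqP => [bn|_]; last by rewrite normr0 expR_ge0.
rewrite ger0_norm ?expR_ge0// ler_expR lerN2 [leRHS]mulrC ler_wpM2l//.
by have := blockP n; rewrite bn => /andP[].
Qed.

(** Taking the block loss to be $e^{\sigma j/2}$, the decay $e^{-\sigma j}$ of the translation
    leaves a convergent geometric series. *)
Lemma tau_norm2_even k sigma : block_bound -> (0 < k)%N -> 0 < sigma ->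
  exists2 K, 0 < K & forall P, N (2 * k)%:R (tau sigma P) <= K * N 2 P.
Proof.
move=> hB k0 s0; have k1 : 1 <= (2 * k)%:R :> R by rewrite ler1n muln_gt0.
have e0 : 0 < sigma / 2 by rewrite divr_gt0.
have [A A0 hA] := hB k _ k0 e0.
have G0 : 0 < (1 - expR (- (sigma / 2)))^-1.
  by rewrite invr_gt0 subr_gt0 expR_lt1 oppr_lt0.
exists (A * (1 - expR (- (sigma / 2)))^-1); first exact: mulr_gt0.
move=> P; set J := (block (size P)).+1.
rewrite -[in tau sigma P](@block_part_sum P J); last first.
  by move=> n nP; rewrite ltnS block_le// ltnW.
have -> : tau sigma (\sum_(j < J) block_part j P) = \sum_(j < J) tau sigma (block_part j P).
  apply/polyP => n; rewrite coef_mulw !coef_sum mulr_suml.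
  by apply: eq_bigr => j _; rewrite [in RHS]coef_mulw.
apply: (le_trans (norm_sum _ _ _ k1)).
apply: (@le_trans _ _ (\sum_(j < J) A * N 2 P * expR (- (sigma / 2 * j%:R)))); last first.
  rewrite -mulr_sumr [leRHS]mulrAC; apply: ler_wpM2l.
    by rewrite mulr_ge0 ?norm_ge0 ?ler1n// ltW.
  exact: expR_geometric_sum.
apply: ler_sum => j _.
have jb := @inblock_block_part j P.
apply: (le_trans (hA j _ (@inblock_mulw j (fun n => expR (- (lam n * sigma))) _ jb))).
have AE0 : 0 <= A * expR (sigma / 2 * j%:R) by rewrite mulr_ge0 ?expR_ge0// ltW.
apply: (le_trans (ler_wpM2l AE0 (tau_block_norm2 (ltW s0) jb))).
have bP : N 2 (block_part j P) <= 1 * N 2 P.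
  apply: norm2_mulw_le => //; first exact: freq_inj.
  by move=> n _; case: eqP; rewrite ?normr1 ?normr0.
rewrite mul1r in bP.
have AE1 : 0 <= A * expR (sigma / 2 * j%:R) * expR (- (sigma * j%:R)) by rewrite mulr_ge0 ?expR_ge0.
rewrite mulrA; apply: (le_trans (ler_wpM2l AE1 bP)).
rewrite le_eqVlt; apply/orP; left; apply/eqP.
rewrite -(mulrA A) -expRD.
have -> : sigma / 2 * j%:R - sigma * j%:R = - (sigma / 2 * j%:R) by field.
by rewrite mulrAC.
Qed.

Lemma tauE sigma P n : (tau sigma P)`_n = P`_n * (expR (- (lam n * sigma)))%:C.
Proof. exact: coef_mulw. Qed.

(* Optimising [3 |g|_2^2 <= 2 s |g|_1 + s^-2 |g|_4^4] over [s] on Gaussian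
   pieces of the spectrum, which unlike sharp blocks do not increase the
   1-norm. *)
Lemma tau_norm12 sigma : block_bound -> 0 < sigma ->
  exists2 C, 0 < C & forall P, N 2 (tau sigma P) <= C * N 1 P.
Proof.
(* Put $E=e^{2rj}$. The weight $e^{-2\sigma j}=E^{-5}$ has to beat the growth $E^4$ that
   interpolation yields, leaving the summable $E^{-1}$. *)
move=> hB s0; pose r := sigma / 5; have r0 : 0 < r by rewrite divr_gt0.
have sE : sigma = 5 * r by rewrite /r; field.
have [K K0 hK] := tau_norm2_even hB (isT : (0 < 2)%N) r0.
(* The maximum of $6rx-x^2/4$ is $36r^2$; here $x=\lambda_n-j$ and the Gaussian is $e^{-x^2/4}$. *)
pose C0 := expR (36 * r ^+ 2).
pose G := (1 - expR (- (2 * r)))^-1.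
have G0 : 0 < G by rewrite invr_gt0 subr_gt0 expR_lt1 oppr_lt0 mulr_gt0.
pose M := (K * C0) ^+ 4.
have M0 : 0 < M by rewrite exprn_gt0// mulr_gt0// expR_gt0.
pose C := 1 + 128 * G ^+ 3 * M.
have C1 : 1 <= C.
  by rewrite lerDl; apply: mulr_ge0; [rewrite mulr_ge0 ?exprn_ge0// ltW|exact: ltW].
have Cp : 0 < C by exact: lt_le_trans C1.
exists C => // P.
set S := N 2 (tau sigma P); set F := N 1 P.
have S0 : 0 <= S by apply: norm_ge0; rewrite ler1n.
have F0 : 0 <= F by exact: norm_ge0.
set J := (block (size P)).+1.
have PJ n : (n < size P)%N -> (block n < J)%N by move=> nP; rewrite ltnS block_le// ltnW.
pose L := lam (size P) + J%:R.
have L0 : 0 <= L by rewrite addr_ge0 ?freq_ge0.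
have d0 : 0 < 2^-1 :> R by rewrite invr_gt0.
have [w hw] := choice (fun j : nat => gaussian_multiplier lam (j%:R : R) L0 d0).
pose g j := mulw (w j \o lam) P.
have lamL n j : (n < size P)%N -> (j < J)%N -> `|lam n - j%:R| <= L.
  move=> nP jJ; have ln := freq_le (ltnW nP).
  have jR : j%:R <= J%:R :> R by rewrite ler_nat ltnW.
  have := freq_ge0 n; have := ler0n R j; have := freq_ge0 (size P).
  by rewrite ler_norml /L => *; apply/andP; split; lra.
have g1 j : N 1 (g j) <= F by exact: (hw j).1.
(* The 4-norm of a piece is bounded through [S], the very quantity to be estimated. Undoing
   [tau lam sigma] costs $e^{5r\lambda}$, and a further $e^{r\lambda}$ makes room for the
   [tau lam r] that passes from the 2-norm to the 4-norm; the Gaussian localises both. *)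
have g4 j : (j < J)%N -> N 4 (g j) <= K * C0 * expR (6 * r * j%:R) * S.
  move=> jJ.
  have gE : g j = tau r (mulw (fun n => expR (lam n * sigma) * w j (lam n) * expR (lam n * r)) (tau sigma P)).
    apply/polyP => n; rewrite tauE coef_mulw tauE coef_mulw /=.
    have {1}-> : w j (lam n) = expR (- (lam n * sigma)) *
        (expR (lam n * sigma) * w j (lam n) * expR (lam n * r)) * expR (- (lam n * r)).
      by rewrite !expRN; field; rewrite !gt_eqF ?expR_gt0.
    by rewrite !rmorphM !mulrA.
  rewrite gE; apply: (le_trans (hK _)); rewrite -!mulrA ler_pM2l// mulrA.
  apply: norm2_mulw_le; [exact: freq_inj|by rewrite mulr_ge0 ?expR_ge0|move=> n nP].
  have {}nP : (n < size P)%N by apply: leq_trans nP (size_mulc _ _).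
  have [w0 _ wle] := (hw j).2 _ (lamL n j nP jJ).
  rewrite ger0_norm; last by rewrite !mulr_ge0 ?expR_ge0.
  rewrite mulrAC -expRD.
  apply: (le_trans (ler_wpM2l (expR_ge0 _) wle)).
  rewrite -!expRD ler_expR sE.
  have := sqr_ge0 ((lam n - j%:R) / 2 - 6 * r); rewrite !expr2; lra.
(* A frequency lies within 1 of the left end of its own block, where the multiplier is at least
   $1/2$; this is the factor 4. *)
have S2 : S ^+ 2 <= \sum_(j < J) expR (- (10 * r * j%:R)) * (4 * N 2 (g j) ^+ 2).
  rewrite (norm2_sqr freq_inj (size_mulc _ _)).
  under [leRHS]eq_bigr => j _ do rewrite (norm2_sqr freq_inj (size_mulc _ _)) !mulr_sumr.
  rewrite exchange_big; apply: ler_sum => i _ /=.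
  have bi := PJ i (ltn_ord i).
  rewrite (bigD1 (Ordinal bi))//= -[leLHS]addr0; apply: lerD; last first.
    apply: sumr_ge0 => j _; rewrite mulr_ge0 ?expR_ge0// mulr_ge0//.
    exact: sqr_ge0.
  rewrite tauE !coef_mulw /= !Normc.normcM !normc_real !exprMn !real_normK ?num_real//.
  have /andP[b1 b2] := blockP i; rewrite -natr1 in b2.
  have [w0 wge _] := (hw (block i)).2 _ (lamL i _ (ltn_ord i) bi).
  have w12 : 1 <= 4 * w (block i) (lam i) ^+ 2.
    have : (lam i - (block i)%:R) ^+ 2 <= 1 by rewrite expr_le1//; lra.
    by nra.
  rewrite !(mulrCA _ (normc _ ^+ 2)); apply: ler_wpM2l; first exact: sqr_ge0.
  rewrite -[leLHS]mulr1; apply: ler_pM => //.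
  by rewrite -expRM_natl ler_expR sE; nra.
have key t : 0 < t -> 3 * S ^+ 2 <= 4 * G * (2 * t * F + t ^- 2 * (M * S ^+ 4)).
  move=> t0; apply: (@le_trans _ _ (3 * (\sum_(j < J) expR (- (10 * r * j%:R)) * (4 * N 2 (g j) ^+ 2)))).
    by rewrite ler_pM2l.
  set X := 2 * t * F + t ^- 2 * (M * S ^+ 4).
  have X0 : 0 <= X.
    apply: addr_ge0; first by rewrite !mulr_ge0// ltW.
    apply: mulr_ge0; first by rewrite invr_ge0 exprn_ge0// ltW.
    by apply: mulr_ge0; [exact: ltW|exact: exprn_ge0].
  apply: (@le_trans _ _ (\sum_(j < J) 4 * X * expR (- (2 * r * j%:R)))); last first.
    rewrite -mulr_sumr [leRHS]mulrAC; apply: ler_wpM2l; first exact: mulr_ge0.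
    by apply: expR_geometric_sum; rewrite mulr_gt0.
  rewrite mulr_sumr; apply: ler_sum => j _.
  pose E := expR (2 * r * j%:R).
  have E0 : 0 < E by exact: expR_gt0.
  have eE (m : nat) : expR (2 * m%:R * r * j%:R) = E ^+ m.
    by rewrite /E -expRM_natl; congr expR; ring.
  (* The parameter $tE^4$ gives both terms the growth $E^4$: in the second one $E^{-8}$ meets the
     $E^{12}$ of the 4-norm bound. *)
  have := @norm_interpolation _ lam (g j) (t * E ^+ 4) (mulr_gt0 t0 (exprn_gt0 _ E0)).
  have -> : expR (- (10 * r * j%:R)) = E ^- 5.
    by rewrite expRN -eE; congr (expR _)^-1; ring.
  have -> : expR (- (2 * r * j%:R)) = E^-1 by rewrite expRN.
  have h4 : N 4 (g j) ^+ 4 <= M * E ^+ 12 * S ^+ 4.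
    have -> : M * E ^+ 12 * S ^+ 4 = (K * C0 * expR (6 * r * j%:R) * S) ^+ 4.
      have -> : 6 * r * j%:R = 2 * 3%:R * r * j%:R by ring.
      by rewrite eE /M; ring.
    by rewrite lerXn2r ?nnegrE ?norm_ge0 ?ler1n ?mulr_ge0 ?expR_ge0// ?(ltW K0)// g4.
  move: (g1 j) h4; set n1 := N 1 _; set n2 := N 2 _; set n4 := N 4 _ => g1j h4 hi.
  have {}hi : 3 * n2 ^+ 2 <= 2 * (t * E ^+ 4) * F + (t * E ^+ 4) ^- 2 * (M * E ^+ 12 * S ^+ 4).
    apply: (le_trans hi); apply: lerD; apply: ler_wpM2l => //.
      by rewrite !mulr_ge0 ?exprn_ge0// ltW.
    by rewrite invr_ge0 exprn_ge0// mulr_ge0 ?exprn_ge0// ltW.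
  have E5 : 0 <= 4 * E ^- 5 by rewrite mulr_ge0 ?invr_ge0 ?exprn_ge0// ltW.
  have := ler_wpM2l E5 hi.
  have -> : 4 * E ^- 5 * (3 * n2 ^+ 2) = 3 * (E ^- 5 * (4 * n2 ^+ 2)) by ring.
  move=> /le_trans; apply; rewrite le_eqVlt; apply/orP; left; apply/eqP.
  by rewrite /X; field; rewrite !gt_eqF.
have [S_0|SN0] := eqVneq S 0; first by rewrite S_0 mulr_ge0// ltW.
have Sp : 0 < S by rewrite lt_neqAle eq_sym SN0.
(* [F'] stands in for [F], which could vanish. The choice of [t] turns the first term of [key] into
   $S^2$, absorbed by the left side, and cancels $S^4$ against $t^{-2}$ in the second. *)
have bound F' : 0 < F' -> F <= F' -> S <= C * F'.
  move=> F'0 FF'.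
  have t0 : 0 < S ^+ 2 / (8 * G * F') by rewrite divr_gt0 ?exprn_gt0// !mulr_gt0.
  have := key _ t0; set t := S ^+ 2 / _ => h.
  have {}h : 3 * S ^+ 2 <= S ^+ 2 + 256 * G ^+ 3 * M * F' ^+ 2.
    apply: (le_trans h).
    apply: (@le_trans _ _ (4 * G * (2 * t * F' + t ^- 2 * (M * S ^+ 4)))).
      apply: ler_wpM2l; first by rewrite mulr_ge0// ltW.
      by rewrite lerD2r; apply: ler_wpM2l => //; rewrite mulr_ge0// ltW.
    rewrite le_eqVlt; apply/orP; left; apply/eqP; rewrite /t; field.
    by rewrite !gt_eqF.
  have {}h : S ^+ 2 <= 128 * G ^+ 3 * M * F' ^+ 2 by lra.
  rewrite -(@ler_pXn2r _ 2) ?nnegrE ?mulr_ge0 ?(ltW F'0) ?(ltW Cp)//.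
  apply: (le_trans h); rewrite exprMn ler_wpM2r ?sqr_ge0//.
  apply: (@le_trans _ _ C); first by rewrite lerDr.
  by rewrite expr2 ler_peMr// ltW.
apply/ler_addgt0Pr => e e0.
have -> : C * F + e = C * (F + e / C) by field; rewrite gt_eqF.
by apply: bound; rewrite ?ltr_wpDl ?lerDl ?divr_ge0 ?divr_gt0// ltW.
Qed.

Lemma tau_tau (s t : R) P : tau s (tau t P) = tau (s + t) P.
Proof.
rewrite /tau mulw_mulw; apply: mulw_eq => n _.
by rewrite -expRD mulrDr opprD addrC.
Qed.

(** Both directions between [p] and [q] are included: the study of the completion goes from [q] to 2
    and back. *)
Definition smoothing := forall p q sigma, 1 <= p -> 1 <= q -> 0 < sigma ->
  exists2 K, 0 < K & forall P, N q (tau sigma P) <= K * N p P.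

Lemma block_bound_smoothing : block_bound -> smoothing.
Proof.
move=> hB p q sigma p1 q1 s0.
have s20 : 0 < sigma / 2 by rewrite divr_gt0.
pose k := (Num.truncn q).+1.
have qk : q <= (2 * k)%:R.
  have qk : q <= k%:R by apply/ltW; rewrite /k truncnS_gt.
  by rewrite (le_trans qk)// ler_nat leq_pmull.
have [C C0 hC] := tau_norm12 hB s20.
have [K K0 hK] := tau_norm2_even hB (isT : (0 < k)%N) s20.
exists (K * C); first exact: mulr_gt0.
move=> P; rewrite (splitr sigma) -tau_tau.
apply: (le_trans (norm_mono _ _ q1 qk)); apply: (le_trans (hK _)).
rewrite -mulrA ler_pM2l//; apply: (le_trans (hC _)); rewrite ler_pM2l//.
exact: norm_mono.
Qed.

End BlockBounds.

(** * The completion *)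

Section Completion.
Context {R : realType}.
Local Open Scope complex_scope.
Local Notation normc := Normc.normc.
Variable lam : nat -> R.
Hypothesis hlam : frequency lam.
Implicit Types (P Q : nat -> {poly R[i]}) (D E F : nat -> R[i]) (p q sigma : R).
Local Notation N := (dnorm lam).

Lemma cauchyE p P : dirichlet_cauchy lam p P <->
  forall e : R, 0 < e -> exists M : nat, forall m n : nat,
    (M <= m)%N -> (M <= n)%N -> N p (P m - P n) < e.
Proof.
split=> h e e0; have [M hM] := h e e0; exists M => m n Mm Mn.
  by rewrite -dnormE; exact: hM.
by rewrite dnormE; exact: hM.
Qed.

Lemma coef_sum_small P (s : nat) (e : R) : 0 < e ->
  (forall n, normc (P m)`_n @[m --> \oo] --> (0 : R)) ->
  exists M, forall m, (M <= m)%N -> \sum_(i < s) normc (P m)`_i <= e.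
Proof.
move=> + P0; elim: s e => [|s ih] e e0; first by exists 0%N => m _; rewrite big_ord0 ltW.
have e20 : 0 < e / 2 by rewrite divr_gt0.
have [M hM] := ih _ e20; have /cvgrPdist_le/(_ _ e20)[M' _ hM'] := P0 s.
exists (maxn M M') => m; rewrite geq_max => /andP[m1 m2].
rewrite big_ord_recr /= [leRHS]splitr; apply: lerD; first exact: hM.
by have := hM' m m2; rewrite /= sub0r normrN; apply: le_trans; exact: ler_norm.
Qed.

Lemma cvg0_mulr (f : nat -> R) (c : R) :
  f m @[m --> \oo] --> (0 : R) -> f m * c @[m --> \oo] --> (0 : R).
Proof. by move=> f0; have := cvgM f0 (cvg_cst c); rewrite mul0r; exact. Qed.

Lemma cvg_affine (f : nat -> R) (a b l : R) :
  f m @[m --> \oo] --> l -> a * f m + b @[m --> \oo] --> a * l + b.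
Proof. by move=> fl; apply: cvgD; [exact: (cvgM (cvg_cst a) fl)|exact: cvg_cst]. Qed.

(** Truncation to the support of [P m] is a contraction by Parseval. It splits [P m] into a
    truncated difference [P m - P n], small by the Cauchy property, and finitely many coefficients
    of [P n], small for large [n]. *)
Lemma cauchy2_cvg0 P :
  dirichlet_cauchy lam 2 P ->
  (forall n, normc (P m)`_n @[m --> \oo] --> (0 : R)) ->
  forall e, 0 < e -> exists M, forall m, (M <= m)%N -> N 2 (P m) <= e.
Proof.
move=> /cauchyE cP P0 e e0; have n1 : 1 <= 2 :> R by rewrite ler1n.
have e20 : 0 < e / 2 by rewrite divr_gt0.
have [M hM] := cP _ e20; exists M => m Mm.
have [M' hM'] := coef_sum_small (size (P m)) e20 P0.
pose n := maxn M M'; pose T (X : {poly R[i]}) := mulw (fun i => (i < size (P m))%:R) X.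
have TP : T (P m) = P m.
  rewrite -[RHS]mulw_id; apply: mulw_eq => i ->//.
have PE : P m = (P m - P n) + P n by rewrite subrK.
rewrite -TP PE.
have TD (A B : {poly R[i]}) : T (A + B) = T A + T B.
  by apply/polyP => i; rewrite coefD !coef_mulw coefD mulrDl.
rewrite TD; apply: (le_trans (normD _ _ _ n1)); rewrite [leRHS]splitr; apply: lerD.
  apply: (@le_trans _ _ (1 * N 2 (P m - P n))).
    apply: norm2_mulw_le => //; first exact: freq_inj hlam.
    by move=> i _; case: (i < _)%N; rewrite ?normr1 ?normr0.
  by rewrite mul1r ltW// hM// leq_maxl.
have sT : (size (T (P n)) <= size (P m))%N.
  apply/leq_sizeP => i iP; rewrite coef_mulw ltnNge iP mulr0//.
apply: (le_trans (norm_le_coef _ n1 sT)); apply: le_trans (hM' n _); last exact: leq_maxr.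
by apply: ler_sum => i _; rewrite coef_mulw ltn_ord mulr1.
Qed.

(* For a fixed Gaussian multiplier [w], smoothing gives [N q (mulw w (P m)) --> 0];
   letting [w] tend to 1 costs nothing, since its norm is at most 1 throughout. *)
Lemma cauchy_cvg0 q P : smoothing lam -> 1 <= q -> dirichlet_cauchy lam q P ->
  (forall n, normc (P m)`_n @[m --> \oo] --> (0 : R)) ->
  forall e, 0 < e -> exists M, forall m, (M <= m)%N -> N q (P m) <= e.
Proof.
move=> hS q1 /[dup] cP /cauchyE cP' P0 e e0; have n1 : 1 <= 2 :> R by rewrite ler1n.
have e20 : 0 < e / 2 by rewrite divr_gt0.
have e40 : 0 < e / 4 by rewrite divr_gt0.
have [M hM] := cP' _ e20; exists M => n Mn.
have [K K0 hK] := hS q 2 1 q1 n1 ltr01.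
have [K' K'0 hK'] := hS 2 q 1 n1 q1 ltr01.
have cT : dirichlet_cauchy lam 2 (fun m => tau lam 1 (P m)).
  apply/cauchyE => d d0; have [M1 hM1] := cP' (d / K) ltac:(by rewrite divr_gt0).
  exists M1 => i j i1 j1; rewrite /tau -mulcB; apply: (le_lt_trans (hK _)).
  by rewrite mulrC -ltr_pdivlMr// hM1.
have T0 : forall i, normc (tau lam 1 (P m))`_i @[m --> \oo] --> (0 : R).
  move=> i; under eq_cvg => m do rewrite coef_mulw Normc.normcM.
  by apply: cvg0_mulr; exact: P0.
pose A := \sum_(i < size (P n)) normc (P n)`_i; pose l := lam (size (P n)).
have A0 : 0 <= A by apply: sumr_ge0 => i _; exact: normc_ge0.
(* As $1-w(\lambda)\le d\lambda^2$, this makes [P n - W (P n)] at most [e / 4] for the fixed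
   polynomial [P n]. *)
pose d := e / 4 / (A * l ^+ 2 + 1).
have Al : 0 < A * l ^+ 2 + 1 by rewrite ltr_wpDl// mulr_ge0// sqr_ge0.
have d0 : 0 < d by rewrite divr_gt0.
(* The maximum of $2\lambda-d\lambda^2/2$ is $2/d$, so [B] bounds the Gaussian after two
   translations by 1 are undone. *)
pose B := expR (2 / d).
have KB0 : 0 < K' * B by rewrite mulr_gt0// expR_gt0.
have [M2 hM2] := cauchy2_cvg0 cT T0 (divr_gt0 e40 KB0).
(* The range [L] depends on [m], which was chosen from [d]. There is no circle: the bounds on [w]
   involve [d] but not [L]. *)
pose m := maxn M M2; pose L := lam (maxn (size (P n)) (size (P m))).
have [w [wN wG]] := gaussian_multiplier lam 0 (freq_ge0 hlam _ : 0 <= L) d0.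
have wG' i : (i < maxn (size (P n)) (size (P m)))%N -> [/\ 0 <= w (lam i),
    1 - d * lam i ^+ 2 <= w (lam i) & w (lam i) <= expR (- (d / 2 * lam i ^+ 2))].
  move=> iL; have := wG (lam i); rewrite subr0; apply.
  by rewrite ger0_norm ?freq_ge0// freq_le// ltnW.
pose W (X : {poly R[i]}) := mulw (w \o lam) X.
have -> : P n = (P n - W (P n)) + (W (P n - P m) + W (P m)).
  have -> : W (P n - P m) = W (P n) - W (P m) by exact: mulcB.
  by ring.
apply: (le_trans (normD _ _ _ q1)).
have -> : e = e / 4 + (e / 2 + e / 4) by field.
apply: lerD.
  have sW : (size (P n - W (P n))%R <= size (P n))%N.
    by rewrite (leq_trans (size_polyD _ _))// size_polyN geq_max leqnn size_mulc.
  apply: (le_trans (norm_le_coef _ q1 sW)).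
  apply: (@le_trans _ _ (\sum_(i < size (P n)) normc (P n)`_i * (d * l ^+ 2))).
    apply: ler_sum => i _; rewrite coefB coef_mulw.
    have -> : (P n)`_i - (P n)`_i * ((w \o lam) i)%:C = (P n)`_i * (1 - w (lam i))%:C.
      by rewrite rmorphB rmorph1 mulrBr mulr1.
    rewrite Normc.normcM normc_real ler_wpM2l ?normc_ge0//.
    have iP := ltn_ord i.
    have [w0 w1 w2] := wG' i (leq_trans iP (leq_maxl _ _)).
    have w3 : w (lam i) <= 1.
      apply: (le_trans w2); rewrite -expR0 ler_expR oppr_le0 mulr_ge0 ?sqr_ge0//.
      by rewrite divr_ge0// ltW.
    rewrite ger0_norm ?subr_ge0//; apply: (@le_trans _ _ (d * lam i ^+ 2)); first by lra.
    rewrite ler_wpM2l ?(ltW d0)// lerXn2r ?nnegrE ?freq_ge0//.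
    exact/(freq_le hlam)/ltnW.
  rewrite -mulr_suml -/A.
  have -> : A * (d * l ^+ 2) = e / 4 * (A * l ^+ 2 / (A * l ^+ 2 + 1)) by rewrite /d; ring.
  apply: ler_piMr; first exact: ltW.
  by rewrite ler_pdivrMr// mul1r lerDl.
apply: (le_trans (normD _ _ _ q1)); apply: lerD.
  apply: (le_trans (wN _ _ q1)); apply/ltW/hM => //; exact: leq_maxl.
have -> : W (P m) = tau lam 1
    (mulw (fun i => expR (lam i * 1) * w (lam i) * expR (lam i * 1)) (tau lam 1 (P m))).
  apply/polyP => i; rewrite tauE coef_mulw tauE coef_mulw /=.
  have {1}-> : w (lam i) = expR (- (lam i * 1)) *
      (expR (lam i * 1) * w (lam i) * expR (lam i * 1)) * expR (- (lam i * 1)).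
    by rewrite !expRN; field; rewrite !gt_eqF ?expR_gt0.
  by rewrite !rmorphM !mulrA.
apply: (le_trans (hK' _)).
apply: (@le_trans _ _ (K' * (B * N 2 (tau lam 1 (P m))))); last first.
  by rewrite mulrA mulrC -ler_pdivlMr// hM2// leq_maxr.
rewrite ler_pM2l//; apply: norm2_mulw_le; [exact: freq_inj hlam|exact: expR_ge0|move=> i iP].
have {}iP : (i < size (P m))%N by apply: leq_trans iP (size_mulc _ _).
have [w0 w1 w2] := wG' i (leq_trans iP (leq_maxr _ _)).
rewrite ger0_norm ?mulr_ge0 ?expR_ge0// mulrAC -expRD.
apply: (le_trans (ler_wpM2l (expR_ge0 _) w2)).
rewrite -expRD ler_expR -subr_ge0.
have -> : 2 / d - (lam i * 1 + lam i * 1 - d / 2 * lam i ^+ 2) = (d * lam i - 2) ^+ 2 / (2 * d).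
  by field; rewrite gt_eqF.
by rewrite divr_ge0 ?sqr_ge0// mulr_ge0// ltW.
Qed.

(** The value picked by [get] comes with some representing sequence, not a prescribed one;
    comparison with a prescribed sequence goes through [cauchy_cvg0]. *)
Lemma hardy_normP p F : 1 <= p -> hardy lam p F ->
  exists2 P, represents lam p P F & N p (P m) @[m --> \oo] --> hardy_norm lam p F.
Proof.
move=> p1 [P [cP PF]].
suff /getPex [Q QF] : exists v, [set v : R | exists2 P, represents lam p P F
    & dirichlet_norm lam p (P m) @[m --> \oo] --> v] v.
  by under eq_cvg do rewrite dnormE; exists Q.
have : cauchy (N p (P m) @[m --> \oo]).
  apply/cauchy_exP => e e0; move/cauchyE: cP => /(_ e e0)[M hM].
  exists (N p (P M)); exists M => //= m Mm.
  by rewrite /ball /= (le_lt_trans (norm_dist _ _ _ p1))// hM.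
move=> /cauchy_cvg Pc; exists (lim (N p (P m) @[m --> \oo])); exists P => //.
by under eq_cvg do rewrite dnormE.
Qed.

Lemma represents_translation p q sigma K P D : 0 < K -> 
  (forall X, N q (tau lam sigma X) <= K * N p X) ->
  represents lam p P D ->
  represents lam q (fun m => tau lam sigma (P m)) (translation lam sigma D).
Proof.
move=> K0 hK [/cauchyE cP PD]; split.
  apply/cauchyE => e e0; have [M hM] := cP (e / K) ltac:(by rewrite divr_gt0).
  exists M => m n Mm Mn; rewrite /tau -mulcB; apply: (le_lt_trans (hK _)).
  by rewrite mulrC -ltr_pdivlMr// hM.
move=> n; under eq_cvg => m do rewrite tauE /translation -mulrBl Normc.normcM.
by apply: cvg0_mulr; exact: PD.
Qed.

Lemma represents_sub p P Q D E : 1 <= p -> represents lam p P D -> represents lam p Q E ->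
  represents lam p (fun m => P m - Q m) (D \- E).
Proof.
move=> p1 [/cauchyE cP PD] [/cauchyE cQ QE]; split.
  apply/cauchyE => e e0; have e20 : 0 < e / 2 by rewrite divr_gt0.
  have [M hM] := cP _ e20; have [M' hM'] := cQ _ e20.
  exists (maxn M M') => m n; rewrite !geq_max => /andP[m1 m2] /andP[n1 n2].
  have -> : P m - Q m - (P n - Q n) = (P m - P n) + (- (Q m - Q n)) by ring.
  apply: (le_lt_trans (normD _ _ _ p1)); rewrite normN// [ltRHS]splitr.
  by apply: ltrD; [exact: hM|exact: hM'].
move=> n.
apply: (@squeeze_cvgr _ _ _ _ (fun=> 0) (fun m => normc ((P m)`_n - D n) + normc ((Q m)`_n - E n))).
- near=> m; rewrite normc_ge0/= coefB.
  have -> : (P m)`_n - (Q m)`_n - (D \- E) n = ((P m)`_n - D n) + (- ((Q m)`_n - E n)).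
    by rewrite /=; ring.
  by rewrite (le_trans (le_normcD _ _))// normcN.
- exact: cvg_cst.
- by have := cvgD (PD n) (QE n); rewrite addr0; exact.
Unshelve. all: end_near. Qed.

Lemma smoothing_hypercontractive : smoothing lam -> hypercontractive lam.
Proof.
move=> hS p q sigma p1 pq s0; have q1 : 1 <= q by rewrite (le_trans p1)// ltW.
have [K K0 hK] := hS p q sigma p1 q1 s0.
split.
  move=> D [P PD]; exists (fun m => tau lam sigma (P m)).
  exact: represents_translation K0 hK PD.
move=> D [PD hD] e e0.
exists (e / K); first by rewrite divr_gt0.
move=> E [PE hE] hlt.
have hF : hardy lam p (E \- D) by exists (fun m => PE m - PD m); exact: represents_sub.
have [P PF Pv] := hardy_normP p1 hF.
have trE : translation lam sigma E \- translation lam sigma D = translation lam sigma (E \- D).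
  by apply/funext => n; rewrite /translation /= mulrBl.
rewrite trE.
have repT := represents_translation K0 hK PF.
have hT : hardy lam q (translation lam sigma (E \- D)) by exists (fun m => tau lam sigma (P m)).
(* [Q] and the translates of [P] represent the same series. Their difference represents 0, so its
   norms tend to 0 and the bound along [P] passes to [Q]. *)
have [Q QF Qv] := hardy_normP q1 hT.
have [cQT QT0] := represents_sub q1 QF repT.
have QTn0 n : normc (Q m - tau lam sigma (P m))`_n @[m --> \oo] --> (0 : R).
  by have := QT0 n; under eq_cvg => m do rewrite /= subrr subr0.
have h0 := cauchy_cvg0 hS q1 cQT QTn0.
have le_v : hardy_norm lam q (translation lam sigma (E \- D)) <= K * hardy_norm lam p (E \- D).
  apply/ler_addgt0Pr => d d0; have [M hM] := h0 d d0.
  have KPv : K * N p (P m) + d @[m --> \oo] --> K * hardy_norm lam p (E \- D) + d.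
    exact: cvg_affine.
  apply: (ler_cvg_to Qv KPv); near=> m.
  have Mm : (M <= m)%N by near: m; exists M.
  rewrite -[Q m](subrK (tau lam sigma (P m))) addrC; apply: (le_trans (normD _ _ _ q1)).
  by apply: lerD; [exact: hK|exact: hM].
by apply: (le_lt_trans le_v); rewrite mulrC -ltr_pdivlMr.
Unshelve. all: end_near. Qed.

(** This is the case [k = 1], which lies outside hypercontractivity because there [p < q]. The
    weights are at most 1, so Parseval suffices. *)
Lemma maps_into_2 sigma : 0 < sigma -> maps_into lam sigma 2 2.
Proof.
move=> s0 D [P PD]; exists (fun m => tau lam sigma (P m)).
apply: (@represents_translation _ _ _ 1 _ _ _ _ PD) => // Q.
apply: norm2_mulw_le => //; first exact: freq_inj hlam.
move=> n _; rewrite ger0_norm ?expR_ge0//; apply: (@le_trans _ _ (expR 0)); last by rewrite expR0.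
by rewrite ler_expR oppr_le0; apply: mulr_ge0; [exact: freq_ge0|exact: ltW].
Qed.

Lemma hypercontractive_maps_into : hypercontractive lam ->
  forall (sigma : R) (k : nat), 0 < sigma -> (1 <= k)%N ->
      maps_into lam sigma 2 (2 * k)%:R.
Proof.
move=> hH sigma [|[|k]]// s0 _; first exact: maps_into_2.
have h1 : 1 <= 2 :> R by rewrite ler1n.
have h2 : 2 < (2 * k.+2)%:R :> R by rewrite ltr_nat !mulnS.
by have [] := hH 2 _ sigma h1 h2 s0.
Qed.

End Completion.

(** * From smoothing to blocks *)

Section FatouEven.
Context {R : realType}.
Local Open Scope complex_scope.
Local Notation normc := Normc.normc.
Variable lam : nat -> R.
Hypothesis hlam : frequency lam.
Local Notation N := (dnorm lam).

(** The contribution to [evenform] of frequency sums at most [L]. Frequencies being nonnegative, it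
    involves only indices with $\lambda_i\le L$, so it stabilises in [n] and is continuous in
    finitely many coefficients. *)
Definition qform (k n : nat) (L : R) (c : nat -> R[i]) : R :=
  \sum_(x : {ffun 'I_k -> 'I_n} | \sum_i lam (x i) <= L)
    \sum_(y : {ffun 'I_k -> 'I_n} | \sum_i lam (x i) == \sum_i lam (y i))
      cre (\prod_i c (x i)) (\prod_i c (y i)).

Lemma expsum_form_ge0 (I : finType) (c : I -> R[i]) (theta : I -> R) :
  0 <= \sum_i \sum_(j | theta i == theta j) cre (c i) (c j).
Proof.
apply: (has_mean_le _ _ _ (@has_mean_cst R 0) (@has_mean_expsum_sqr R I c theta)).
- exact: bmeas_cst.
- exact/tpoly_bmeas/tpoly_expsum_sqr.
- by move=> t; exact: sqr_ge0.
Qed.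

(** The discarded part is $\sum_{\mu>L}|c_\mu|^2$, the form of the tuple family with the
    coefficients of sums at most [L] set to 0. Its sign holds for complex coefficients. *)
Lemma qform_le_evenform k n L (c : nat -> R[i]) :
  qform k n L c <= evenform k (fun i : 'I_n => c i) (fun i => lam i).
Proof.
rewrite /evenform (bigID (fun x : {ffun 'I_k -> 'I_n} => \sum_i lam (x i) <= L)) /=.
rewrite lerDl.
pose th (x : {ffun 'I_k -> 'I_n}) := \sum_i lam (x i).
pose c' (x : {ffun 'I_k -> 'I_n}) := if th x <= L then 0 else \prod_i c (x i).
have := expsum_form_ge0 c' th; congr (_ <= _).
rewrite [RHS]big_mkcond; apply: eq_bigr => x _; rewrite /c' -/(th x).
case: ifP => hx /=.
  by apply: big1 => y _; rewrite /cre /= !mul0r addr0.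
by apply: eq_bigr => y /eqP hy; rewrite -hy hx.
Qed.

(** [F] and [B] take functions into [nat], so that one summand makes sense over both index
    ranges. *)
Lemma big_ffun_widen k n s (ns : (n.+1 <= s)%N) (F : ('I_k -> nat) -> R)
    (B : ('I_k -> nat) -> bool) :
  (forall x : 'I_k -> nat, B x -> forall i, (x i < n.+1)%N) ->
  \sum_(x : {ffun 'I_k -> 'I_s} | B (fun i => x i)) F (fun i => x i) =
  \sum_(x : {ffun 'I_k -> 'I_n.+1} | B (fun i => x i)) F (fun i => x i).
Proof.
move=> Bn.
rewrite (reindex_onto (fun x : {ffun 'I_k -> 'I_n.+1} => [ffun i => widen_ord ns (x i)])
  (fun y : {ffun 'I_k -> 'I_s} => [ffun i => inord (y i) : 'I_n.+1])) /=; last first.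
  move=> y By; apply/ffunP => i; rewrite !ffunE; apply: val_inj => /=.
  by rewrite inordK//; exact: (Bn _ By).
have E (x : {ffun 'I_k -> 'I_n.+1}) :
    (fun i => nat_of_ord ([ffun i => widen_ord ns (x i)] i)) = (fun i => nat_of_ord (x i)).
  by apply/funext => i; rewrite ffunE.
apply: eq_big => x; last by rewrite E.
rewrite E [X in _ && X](_ : _ = true) ?andbT//.
by apply/eqP/ffunP => i; rewrite !ffunE /= inord_val.
Qed.

Lemma qform_widen k n s L (c : nat -> R[i]) : (n.+1 <= s)%N ->
  (forall m, (n < m)%N -> L < lam m) -> qform k s L c = qform k n.+1 L c.
Proof.
move=> ns hL.
have small (x : 'I_k -> nat) : \sum_i lam (x i) <= L -> forall i, (x i < n.+1)%N.
  move=> xL i; rewrite ltnNge; apply/negP => /hL; apply/negP; rewrite -leNgt.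
  apply: le_trans xL; rewrite (bigD1 i)//= lerDl; apply: sumr_ge0 => j _; exact: freq_ge0.
rewrite /qform.
transitivity (\sum_(x : {ffun 'I_k -> 'I_s} | \sum_i lam (x i) <= L)
    \sum_(y : {ffun 'I_k -> 'I_n.+1} | \sum_i lam (x i) == \sum_i lam (y i))
      cre (\prod_i c (x i)) (\prod_i c (y i))).
  apply: eq_bigr => x xL.
  apply: (@big_ffun_widen k n s ns (fun y => cre (\prod_i c (x i)) (\prod_i c (y i)))
    (fun y => \sum_i lam (x i) == \sum_i lam (y i))) => y /eqP xy; apply: small.
  by rewrite -xy.
exact: (@big_ffun_widen k n s ns (fun x =>
    \sum_(y : {ffun 'I_k -> 'I_n.+1} | \sum_i lam (x i) == \sum_i lam (y i))
      cre (\prod_i c (x i)) (\prod_i c (y i))) (fun x => \sum_i lam (x i) <= L)).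
Qed.

Definition cvgc (u : nat -> R[i]) (z : R[i]) :=
  (complex.Re (u m) @[m --> \oo] --> complex.Re z) /\
  (complex.Im (u m) @[m --> \oo] --> complex.Im z).

Lemma cvgc_normc u z : normc (u m - z) @[m --> \oo] --> (0 : R) -> cvgc u z.
Proof.
have Re_le (w : R[i]) : `|complex.Re w| <= normc w /\ `|complex.Im w| <= normc w.
  case: w => a b /=; rewrite -!sqrtr_sqr !ler_sqrt ?addr_ge0 ?sqr_ge0//.
  by rewrite lerDl lerDr !sqr_ge0.
move=> /cvgrPdist_le h; split; apply/cvgrPdist_le => e /h; apply: filterS => m.
  rewrite sub0r normrN (ger0_norm (normc_ge0 _)) distrC; apply: le_trans.
  by have [+ _] := Re_le (u m - z); case: (u m) (z) => a b [c d].
rewrite sub0r normrN (ger0_norm (normc_ge0 _)) distrC; apply: le_trans.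
by have [_ +] := Re_le (u m - z); case: (u m) (z) => a b [c d].
Qed.

Lemma cvgc_mul u v z w : cvgc u z -> cvgc v w -> cvgc (fun m => u m * v m) (z * w).
Proof.
have ReM (a b : R[i]) : complex.Re (a * b) = complex.Re a * complex.Re b - complex.Im a * complex.Im b.
  by case: a b => [a1 a2] [b1 b2].
have ImM (a b : R[i]) : complex.Im (a * b) = complex.Re a * complex.Im b + complex.Im a * complex.Re b.
  by case: a b => [a1 a2] [b1 b2].
move=> [uR uI] [vR vI]; split.
  by rewrite ReM; under eq_cvg do rewrite ReM; apply: cvgB; apply: cvgM.
by rewrite ImM; under eq_cvg do rewrite ImM; apply: cvgD; apply: cvgM.
Qed.

Lemma cvgc_prod (I : finType) (u : I -> nat -> R[i]) (z : I -> R[i]) :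
  (forall i, cvgc (u i) (z i)) -> cvgc (fun m => \prod_i u i m) (\prod_i z i).
Proof.
move=> h; rewrite unlock /=; elim: (index_enum I) => [|i s ih] /=.
  by split; exact: cvg_cst.
exact: cvgc_mul.
Qed.

Lemma cvg_cre u v z w : cvgc u z -> cvgc v w -> cre (u m) (v m) @[m --> \oo] --> cre z w.
Proof. by move=> [uR uI] [vR vI]; apply: cvgD; apply: cvgM. Qed.

Lemma cvg_qform k n L (c : nat -> nat -> R[i]) (d : nat -> R[i]) :
  (forall i, cvgc (fun m => c m i) (d i)) ->
  qform k n L (c m) @[m --> \oo] --> qform k n L d.
Proof.
move=> cd; apply: cvg_big => [|x _]; first exact: add_continuous.
apply: cvg_big => [|y _]; first exact: add_continuous.
by apply: cvg_cre; exact: cvgc_prod.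
Qed.

(* Since [lam] tends to infinity, only finitely many tuples of indices have a
   given sum of frequencies, so each coefficient of the [k]-th power of a
   Dirichlet series is a finite sum. *)
Lemma fatou_even k (P : nat -> {poly R[i]}) (d b : nat -> R) (Q : {poly R[i]}) (M : R) :
  (0 < k)%N -> (forall n, normc ((P m)`_n - (d n)%:C) @[m --> \oo] --> (0 : R)) ->
  (exists m0, forall m, (m0 <= m)%N -> N (2 * k)%:R (P m) <= M) ->
  (forall n, Q`_n = (b n)%:C) -> (forall n, 0 <= b n <= d n) ->
  N (2 * k)%:R Q <= M.
Proof.
move=> k0 Pd [m0 PM] Qb bd.
have k1 : 1 <= (2 * k)%:R :> R by rewrite ler1n muln_gt0.
have M0 : 0 <= M by apply: le_trans (PM m0 _) => //; exact: norm_ge0.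
rewrite -(@ler_pXn2r _ (2 * k)) ?muln_gt0 ?nnegrE ?norm_ge0//.
(* Every [k]-tuple from the support of [Q] has frequency sum at most [L]. *)
pose L := lam (size Q) *+ k.
have [n [nQ nL]] : exists n, (size Q <= n.+1)%N /\ forall m, (n < m)%N -> L < lam m.
  case: hlam => _ _ /cvgryPgt/(_ L)[n0 _ hn0].
  exists (maxn n0 (size Q)); split; first by rewrite (leq_trans (leq_maxr n0 _)).
  by move=> m; rewrite gtn_max => /andP[/ltnW h _]; exact: hn0.
have qP m : (m0 <= m)%N -> qform k n.+1 L (fun i => (P m)`_i) <= M ^+ (2 * k).
  move=> mm; pose s := maxn n.+1 (size (P m)).
  rewrite -(@qform_widen k n s)//; last exact: leq_maxl.
  apply: (le_trans (qform_le_evenform _ _ _ _)).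
  by rewrite -norm_even ?leq_maxr// lerXn2r ?nnegrE ?norm_ge0// PM.
have qD : qform k n.+1 L (fun i => (d i)%:C) <= M ^+ (2 * k).
  have /cvgr_to_le := @cvg_qform k n.+1 L (fun m i => (P m)`_i) (fun i => (d i)%:C)
    (fun i => cvgc_normc (Pd i)).
  by apply; exists m0.
apply: le_trans qD; rewrite (norm_even _ k0 nQ) /evenform /qform [leRHS]big_mkcond.
apply: ler_sum => x _.
have prodE (f g : nat -> R) (z : {ffun 'I_k -> 'I_n.+1}) : (forall i, f i = g i) ->
    \prod_i (f (z i))%:C = (\prod_i g (z i))%:C.
  by move=> fg; rewrite rmorph_prod; apply: eq_bigr => i _; rewrite fg.
have QE (z : {ffun 'I_k -> 'I_n.+1}) : \prod_i Q`_(z i) = (\prod_i b (z i))%:C.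
  by rewrite rmorph_prod; apply: eq_bigr => i _; rewrite Qb.
have dE (z : {ffun 'I_k -> 'I_n.+1}) : \prod_i (d (z i))%:C = (\prod_i d (z i))%:C.
  by rewrite rmorph_prod.
case: ifP => xL.
  apply: ler_sum => y _; rewrite !QE !dE !cre_real.
  by apply: ler_pM; rewrite ?prodr_ge0//; try (by move=> i _; have /andP[] := bd (x i));
    try (by move=> i _; have /andP[] := bd (y i)); apply: ler_prod => i _; exact: bd.
apply: sumr_le0 => y _; rewrite !QE !cre_real.
(* A sum above [L] forces an index outside the support of [Q]. *)
suff -> : \prod_i b (x i) = 0 by rewrite mul0r.
apply/eqP/negPn/negP => /prodf_neq0 bx; move/negP: xL; apply.
rewrite /L -[X in _ *+ X]card_ord -sumr_const; apply: ler_sum => i _.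
apply: freq_le => //; rewrite leqNgt; apply/negP => hi.
have := Qb (x i); rewrite (nth_default _ (ltnW hi)) => /(congr1 (@complex.Re R)) /= b0.
by have := bx i isT; rewrite -b0 eqxx.
Qed.

End FatouEven.

(** * Gluing near-extremal block polynomials *)

Section MapsIntoBlocks.
Context {R : realType}.
Local Open Scope complex_scope.
Local Notation normc := Normc.normc.
Variable lam : nat -> R.
Hypothesis hlam : frequency lam.
Local Notation N := (dnorm lam).
Implicit Types (X Y : {poly R[i]}).

Lemma block_index_bound (j : nat) : exists n, forall X, inblock lam j X -> (size X <= n)%N.
Proof.
case: (hlam) => _ _ /cvgryPge/(_ j.+1%:R)[n _ hn]; exists n => X jX.
apply/leq_sizeP => i ni; apply/eqP; apply/negPn/negP => /jX /andP[_].
by rewrite ltNge hn.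
Qed.

Lemma block_norm_crude (j : nat) : exists2 C : R, 0 <= C &
  forall p X, 1 <= p -> inblock lam j X -> N p X <= C * N 2 X.
Proof.
have [n hn] := block_index_bound j; exists n%:R => // p X p1 jX.
apply: (le_trans (norm_le_coef lam p1 (hn _ jX))).
rewrite mulr_natl -[n in leRHS]card_ord -sumr_const.
by apply: ler_sum => i _; exact: (coef_le_norm2 (freq_inj hlam)).
Qed.

Definition nonneg_coefs X := exists2 b : nat -> R, (forall n, 0 <= b n) & forall n, X`_n = (b n)%:C.

Definition absp X : {poly R[i]} := \poly_(n < size X) (normc X`_n)%:C.

Lemma coef_absp X n : (absp X)`_n = (normc X`_n)%:C.
Proof. by rewrite coef_poly; case: ltnP => // h; rewrite nth_default// Normc.normc0. Qed.

Lemma norm_absp k X : (0 < k)%N -> N (2 * k)%:R X <= N (2 * k)%:R (absp X).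
Proof. by move=> k0; apply: (norm_majorant _ k0) => n; [exact: lexx|exact: coef_absp]. Qed.

Lemma norm2_absp X : N 2 (absp X) = N 2 X.
Proof.
have E n : normc (absp X)`_n = normc X`_n.
  by rewrite coef_absp normc_real ger0_norm ?normc_ge0.
apply/eqP; rewrite eq_le; apply/andP; split; apply: (norm2_le (freq_inj hlam)) => n.
  by rewrite E.
by rewrite E.
Qed.

Lemma block_bound_of_nonneg (k j : nat) (B : R) : (0 < k)%N -> 0 <= B ->
  (forall X, inblock lam j X -> nonneg_coefs X -> N 2 X <= 1 -> N (2 * k)%:R X <= B) ->
  forall X, inblock lam j X -> N (2 * k)%:R X <= B * N 2 X.
Proof.
move=> k0 B0 hB X jX; have k1 : 1 <= (2 * k)%:R :> R by rewrite ler1n muln_gt0.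
have n1 : 1 <= 2 :> R by rewrite ler1n.
have [X0|Xn0] := eqVneq (N 2 X) 0.
  have -> : X = 0.
    apply/polyP => n; rewrite coef0; apply: Normc.eq0_normc; apply/eqP.
    by rewrite eq_le normc_ge0 andbT -X0; exact: (coef_le_norm2 (freq_inj hlam)).
  by rewrite !norm0// mulr0.
have a0 : 0 < N 2 X by rewrite lt_neqAle eq_sym Xn0 norm_ge0.
apply: (le_trans (norm_absp _ k0)).
have -> : absp X = mulw (fun=> N 2 X) (mulw (fun=> (N 2 X)^-1) (absp X)).
  rewrite mulw_mulw -[LHS]mulw_id; apply: mulw_eq => n _.
  by rewrite mulVf.
apply: (le_trans (norm_scale _ _ k1 (ltW a0))); rewrite mulrC ler_pM2r//.
apply: hB.
- move=> n; rewrite coef_mulw coef_absp => H; apply: jX; apply: contraNneq H => ->.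
  by rewrite Normc.normc0 mul0r.
- exists (fun n => normc X`_n / N 2 X) => [n|n]; first by rewrite divr_ge0 ?normc_ge0// ltW.
  by rewrite coef_mulw coef_absp rmorphM.
- apply: (@le_trans _ _ ((N 2 X)^-1 * N 2 (absp X))).
    by apply: norm_scale => //; rewrite invr_ge0 ltW.
  by rewrite norm2_absp mulVf.
Qed.

(** The crude block bound makes the supremum finite; missing it by 1 only adds 1 to the block
    constant. *)
Lemma near_maximizer (k j : nat) : (0 < k)%N -> exists Y,
  [/\ inblock lam j Y, nonneg_coefs Y, N 2 Y <= 1 &
  forall X, inblock lam j X -> nonneg_coefs X -> N 2 X <= 1 ->
    N (2 * k)%:R X <= N (2 * k)%:R Y + 1].
Proof.
move=> k0; have k1 : 1 <= (2 * k)%:R :> R by rewrite ler1n muln_gt0.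
pose S := [set v | exists2 X, [/\ inblock lam j X, nonneg_coefs X & N 2 X <= 1]
  & v = N (2 * k)%:R X].
have [C C0 hC] := block_norm_crude j.
have supS : has_sup S.
  split; last first.
    exists C => _ [X [jX _ X1] ->]; apply: (le_trans (hC _ _ k1 jX)).
    by rewrite ler_piMr.
  exists (N (2 * k)%:R 0), 0 => //; split.
  - by move=> n; rewrite coef0 eqxx.
  - by exists (fun=> 0) => // n; rewrite coef0.
  - by rewrite norm0 ?ler1n.
have [_ [Y [jY nY Y1] ->] ltY] := sup_adherent ltr01 supS.
exists Y; split=> // X jX nX X1.
have : N (2 * k)%:R X <= sup S by apply: sup_upper_bound => //; exists X.
move=> /le_trans; apply; rewrite -lerBlDr; exact: ltW.
Qed.

(** By Pythagoras the squared norm of a difference of partial sums is the difference of their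
    squared norms, a bounded monotone sequence. *)
Lemma hardy_2 (D : nat -> R[i]) (C : R) :
  (forall m, N 2 (\poly_(n < m) D n) <= C) -> hardy lam 2 D.
Proof.
move=> hC; pose P m := \poly_(n < m) D n; exists P; split; last first.
  move=> n; apply: cvg_near_cst; exists n.+1 => // m /= nm.
  by rewrite coef_poly nm subrr Normc.normc0.
have n1 : 1 <= 2 :> R by rewrite ler1n.
have C0 : 0 <= C by apply: le_trans (hC 0%N); exact: norm_ge0.
pose a m := N 2 (P m) ^+ 2.
have aB m n : (n <= m)%N -> N 2 (P m - P n) ^+ 2 = a m - a n.
  move=> nm.
  have szP i : (i <= m)%N -> (size (P i) <= m)%N by move=> im; rewrite (leq_trans (size_poly _ _)).
  have szB : (size (P m - P n)%R <= m)%N.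
    by rewrite (leq_trans (size_polyD _ _))// size_polyN geq_max !szP.
  rewrite /a !(norm2_sqr (freq_inj hlam) (n := m)) ?szP// -sumrB.
  apply: eq_bigr => i _; rewrite coefB !coef_poly ltn_ord.
  case: ifP => _; first by rewrite !subrr Normc.normc0 expr0n.
  by rewrite subr0 Normc.normc0 expr0n subr0.
have a_nd : nondecreasing_seq a.
  by move=> n m nm; rewrite -subr_ge0 -aB// sqr_ge0.
have /nondecreasing_is_cvgn : nondecreasing_seq a by [].
have ub : has_ubound (range a).
  by exists (C ^+ 2) => _ [m _ <-]; rewrite /a lerXn2r ?nnegrE ?norm_ge0//; exact: hC.
move=> /(_ ub) /cvgrPdist_lt ca; apply/cauchyE => e e0.
have e20 : 0 < e ^+ 2 / 2 by rewrite divr_gt0// exprn_gt0.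
have [M _ hM] := ca _ e20; exists M => m n Mm Mn.
wlog nm : m n Mm Mn / (n <= m)%N => [hw|].
  have [nm|/ltnW mn] := leqP n m; first exact: hw.
  by rewrite -normN// opprB; exact: hw.
rewrite -(@ltr_pXn2r _ 2) ?nnegrE ?norm_ge0 ?(ltW e0)// aB//.
have := hM m Mm; have := hM n Mn; rewrite /= !ltr_distl => /andP[h1 h2] /andP[h3 h4].
by lra.
Qed.

Lemma maps_into_block_bound :
  (forall (sigma : R) (k : nat), 0 < sigma -> (1 <= k)%N ->
      maps_into lam sigma 2 (2 * k)%:R) -> block_bound lam.
Proof.
move=> hmap k e k0 e0; have k1 : 1 <= (2 * k)%:R :> R by rewrite ler1n muln_gt0.
have n1 : 1 <= 2 :> R by rewrite ler1n.
(* Half of [e] pays for the gluing weights $e^{-sj}$, half for the translation. *)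
pose s := e / 2; have s0 : 0 < s by rewrite divr_gt0.
have [f hf] := choice (fun j => near_maximizer j k0).
pose r j n := complex.Re (f j)`_n.
have r0 j n : 0 <= r j n.
  by have [_ [b b0 bE] _ _] := hf j; rewrite /r bE; exact: b0.
have fE j n : (f j)`_n = (r j n)%:C.
  by have [_ [b b0 bE] _ _] := hf j; rewrite /r bE.
have rblock j n : block lam n != j -> r j n = 0.
  move=> nj; have [jf _ _ _] := hf j; rewrite /r.
  have [->//|/jf/block_eq bn] := eqVneq (f j)`_n 0.
  by rewrite bn eqxx in nj.
pose d n := expR (- (s * (block lam n)%:R)) * r (block lam n) n.
have d0 n : 0 <= d n by rewrite mulr_ge0 ?expR_ge0.
have hD : hardy lam 2 (fun n => (d n)%:C).
  apply: (@hardy_2 _ (1 - expR (- s))^-1) => m; set P := \poly_(n < m) _.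
  have PJ n : (n < size P)%N -> (block lam n < (block lam m).+1)%N.
    by move=> nP; rewrite ltnS block_le// ltnW// (leq_trans nP)// size_poly.
  rewrite -(block_part_sum PJ); apply: (le_trans (norm_sum _ _ _ n1)).
  apply: le_trans (expR_geometric_sum (block lam m).+1 s0); apply: ler_sum => j _.
  have [jf _ f1 _] := hf j.
  apply: (@le_trans _ _ (expR (- (s * j%:R)) * N 2 (f j))); last first.
    by rewrite ler_piMr ?expR_ge0.
  apply: le_trans (norm_scale _ _ n1 (expR_ge0 _)).
  apply: (norm2_le (freq_inj hlam)) => n.
  rewrite !coef_mulw fE coef_poly !Normc.normcM !normc_real.
  case: eqP => [bn|_]; last by rewrite normr0 mulr0 mulr_ge0.
  case: ifP => _; last by rewrite Normc.normc0 mul0r mulr_ge0.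
  by rewrite normc_real /d bn normr1 mulr1 normrM mulrC.
(* The hypothesis is applied to this single series; the bound [M] on the norms of its image is
   therefore the same for every block. *)
have [P [cP Pd]] := hmap s k s0 k0 _ hD.
have [m0 hm0] := (cauchyE _ _ _).1 cP 1 ltr01.
pose M := N (2 * k)%:R (P m0) + 1.
have M0 : 0 <= M by rewrite addr_ge0 ?norm_ge0.
have hM m : (m0 <= m)%N -> N (2 * k)%:R (P m) <= M.
  move=> mm; rewrite -[P m](subrK (P m0)) addrC; apply: (le_trans (normD _ _ _ k1)).
  by rewrite lerD2l ltW// hm0.
pose d' n := d n * expR (- (lam n * s)).
have Pd' n : normc ((P m)`_n - (d' n)%:C) @[m --> \oo] --> (0 : R).
  by rewrite /d' rmorphM; exact: Pd.
(* On block [j] one has $\lambda_n<j+1$, so undoing the translation costs at most $e^{s(j+1)}$ and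
   undoing the weight $e^{sj}$: together $e^s e^{ej}$. The 1 is the defect of [near_maximizer]. *)
exists (expR s * M + 1); first by rewrite ltr_wpDl// mulr_ge0// expR_ge0.
move=> j; pose a := expR s * expR (e * j%:R).
have a0 : 0 < a by rewrite mulr_gt0// expR_gt0.
have ej1 : 1 <= expR (e * j%:R) by rewrite -expR0 ler_expR mulr_ge0// ltW.
have aM0 : 0 <= a * M + 1 by rewrite addr_ge0// mulr_ge0// ltW.
have fj : N (2 * k)%:R (f j) <= a * M.
  pose b n := r j n * (expR (- (s * j%:R)) * expR (- (lam n * s))).
  pose Q := mulw (fun n => expR (- (s * j%:R)) * expR (- (lam n * s))) (f j).
  have Qb n : Q`_n = (b n)%:C by rewrite coef_mulw fE -rmorphM.
  have b0 n : 0 <= b n by rewrite !mulr_ge0 ?expR_ge0.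
  have bd n : 0 <= b n <= d' n.
    rewrite b0 /=; have [bn|nj] := eqVneq (block lam n) j.
      by rewrite /b /d' /d bn mulrCA mulrA.
    by rewrite /b (rblock _ _ nj) mul0r mulr_ge0 ?expR_ge0.
  have QM : N (2 * k)%:R Q <= M.
    by apply: (fatou_even hlam k0 Pd' _ Qb bd); exists m0.
  apply: (@le_trans _ _ (a * N (2 * k)%:R Q)); last by rewrite ler_pM2l.
  apply: le_trans (norm_scale _ _ k1 (ltW a0)).
  apply: (@norm_majorant _ _ _ _ _ (fun n => b n * a)) => // n; last first.
    by rewrite coef_mulw Qb -rmorphM.
  rewrite fE normc_real ger0_norm//.
  have [bn|nj] := eqVneq (block lam n) j; last by rewrite (rblock _ _ nj) mulr_ge0// ltW.
  rewrite /b /a -mulrA; apply: ler_peMr => //.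
  rewrite -!expRD; apply: (@le_trans _ _ (expR 0)); first by rewrite expR0.
  rewrite ler_expR.
  have := blockP hlam n; rewrite bn -natr1 => /andP[_ /ltW lj].
  have eE : e = s + s by rewrite /s -splitr.
  have := ler_wpM2r (ltW s0) lj; rewrite -subr_ge0 => /le_trans; apply.
  rewrite le_eqVlt; apply/orP; left; apply/eqP; rewrite eE; ring.
move=> X jX; apply: (@le_trans _ _ ((a * M + 1) * N 2 X)).
  apply: block_bound_of_nonneg jX => // Y jY nY Y1.
  have [_ _ _ hmax] := hf j.
  by apply: (le_trans (hmax _ jY nY Y1)); rewrite lerD2r.
apply: ler_wpM2r; first exact: norm_ge0.
by rewrite mulrDl mul1r lerD// /a mulrAC.
Qed.

End MapsIntoBlocks.

(** * Additive energy *)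

Section Energy.
Context {R : realType}.
Local Open Scope complex_scope.
Local Notation normc := Normc.normc.
Variable lam : nat -> R.
Hypothesis hlam : frequency lam.
Local Notation N := (dnorm lam).
Implicit Types (X Y : {poly R[i]}) (A : {fset R}) (S : pred nat).

Definition indp (m : nat) S : {poly R[i]} := \poly_(n < m) ((S n)%:R)%:C.

Lemma coef_indp m S n : (indp m S)`_n = (((n < m)%N && S n)%:R)%:C.
Proof. by rewrite coef_poly; case: (n < m)%N. Qed.

Lemma expsum_indp m S A t : A != fset0 ->
  (forall n, (lam n \in A) = (n < m)%N && S n) -> [set` A] `<=` range lam ->
  dirichlet_line lam (indp m S) t = expsum (fun _ : A => 1) (fun a => val a) t.
Proof.
move=> /fset0Pn[a0 a0A] AS Alam; rewrite (lineE lam t (size_poly m _)) /expsum.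
have sA : forall a : A, exists i : 'I_m, lam i = val a.
  move=> a; have [n _ na] := Alam _ (valP a).
  have := valP a; rewrite -na AS => /andP[nm _].
  by exists (Ordinal nm).
have [h hE] := choice sA.
transitivity (\sum_(i < m | lam i \in A) cis (lam i * t)).
  rewrite [RHS]big_mkcond; apply: eq_bigr => i _; rewrite coef_indp AS ltn_ord /=.
  by case: (S i); rewrite ?mul1r ?mul0r.
rewrite (reindex_onto h (fun i : 'I_m => insubd (FSetSub a0A) (lam i))) /=; last first.
  move=> i iA; apply: val_inj; apply: (freq_inj hlam).
  by rewrite /= hE insubdK.
apply: eq_big => a; last by move=> _; rewrite hE mul1r.
rewrite hE (valP a) /=; apply/eqP; apply: val_inj; rewrite insubdK//.
Qed.

Lemma energy_norm k m S A : (0 < k)%N -> A != fset0 ->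
  (forall n, (lam n \in A) = (n < m)%N && S n) -> [set` A] `<=` range lam ->
  N (2 * k)%:R (indp m S) ^+ (2 * k) = (additive_energy k A)%:R /\
  N 2 (indp m S) ^+ 2 = (#|` A|)%:R.
Proof.
move=> k0 A0 AS Alam.
have k1 : 1 <= (2 * k)%:R :> R by rewrite ler1n muln_gt0.
have lE t : line_norm lam (indp m S) (t + 0) = normc (expsum (fun _ : A => 1) (fun a => val a) t).
  by rewrite addr0 /line_norm (expsum_indp t A0 AS Alam).
have cre1 : cre (1 : R[i]) 1 = 1 by rewrite /cre /= mulr1 mulr0 addr0.
split.
  rewrite -(@pmean_natE _ _ (2 * k)%:R)// ?muln_gt0//.
  have := @has_mean_evenform R k A (fun _ => 1) (fun a => val a).
  have -> : evenform k (fun _ : A => 1) (fun a => val a) = (additive_energy k A)%:R.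
    rewrite /evenform; transitivity (\sum_(xy : {ffun 'I_k -> A} * {ffun 'I_k -> A} |
      \sum_i val (xy.1 i) == \sum_i val (xy.2 i)) (1 : R)); last first.
      rewrite /additive_energy -sum1_card natr_sum; apply: eq_bigl => xy.
      by apply/idP/idP => [h|/set_mem//]; exact/mem_set.
    rewrite -(pair_big_dep xpredT (fun x y : {ffun 'I_k -> A} =>
      \sum_i val (x i) == \sum_i val (y i)) (fun _ _ => 1)) /=.
    by do 2 (apply: eq_bigr => ? _); rewrite !prodr_const !expr1n.
  apply: has_mean_uniq.
  have := @has_pmean R lam _ (indp m S) 0 (lt_le_trans ltr01 k1); rewrite /has_mean.
  by under [X in avg X @ _ --> _ -> _]eq_fun => t do rewrite lE powR_mulrn ?normc_ge0//.
rewrite -(@pmean_natE _ _ 2 2)//.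
have := @has_mean_expsum_sqr R A (fun _ => 1) (fun a => val a).
have -> : \sum_(i : A) \sum_(j : A | val i == val j) cre (1 : R[i]) 1 = (#|` A|)%:R.
  rewrite cardfE -sum1_card natr_sum; apply: eq_bigr => a _.
  rewrite (big_pred1 a) ?cre1//.
apply: has_mean_uniq.
have := @has_pmean R lam 2 (indp m S) 0 (ltr0n _ 2); rewrite /has_mean.
by under [X in avg X @ _ --> _ -> _]eq_fun => t do rewrite lE powR_mulrn ?normc_ge0//.
Qed.

(** The ratio in the energy exponent is the square of a ratio of norms of an indicator polynomial,
    the source of the factors 2 between exponents below. *)
Lemma energy_ratio k m S A : (0 < k)%N -> A != fset0 ->
  (forall n, (lam n \in A) = (n < m)%N && S n) -> [set` A] `<=` range lam ->
  0 < N 2 (indp m S) /\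
  (additive_energy k A)%:R `^ k%:R^-1 / (#|` A|)%:R =
    (N (2 * k)%:R (indp m S) / N 2 (indp m S)) ^+ 2.
Proof.
move=> k0 A0 AS Alam; have [E1 E2] := energy_norm k0 A0 AS Alam.
have k1 : 1 <= (2 * k)%:R :> R by rewrite ler1n muln_gt0.
have n1 : 1 <= 2 :> R by rewrite ler1n.
split.
  rewrite lt_neqAle norm_ge0// andbT eq_sym; apply/eqP => X0; move: E2.
  by rewrite X0 expr0n /= => /esym/eqP; rewrite pnatr_eq0 cardfs_eq0 (negbTE A0).
rewrite -E1 -E2 expr_div_n exprM -powR_mulrn ?exprn_ge0 ?norm_ge0// -powRrM.
by rewrite mulfV ?pnatr_eq0 -?lt0n// powRr1// exprn_ge0// norm_ge0.
Qed.

Lemma block_bound_energy : block_bound lam ->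
  forall k : nat, (2 <= k)%N -> energy_exponent lam k j @[j --> \oo] --> (0 : R).
Proof.
move=> hB k k2; have k0 : (0 < k)%N by exact: leq_trans k2.
have k1 : 1 <= (2 * k)%:R :> R by rewrite ler1n muln_gt0.
have n1 : 1 <= 2 :> R by rewrite ler1n.
apply/cvgrPdist_le => e e0.
(* The squared ratio doubles the logarithm, so [e / 4] contributes [e / 2]; the other half absorbs
   the constant [2 * ln c] once [j] is large. *)
have e40 : 0 < e / 4 by rewrite divr_gt0.
have [C C0 hC] := hB k _ k0 e40.
pose c := Num.max 1 C.
have c1 : 1 <= c by rewrite le_max lexx.
have c0 : 0 < c by exact: lt_le_trans c1.
have lnc : 0 <= ln c by rewrite ln_ge0.
near=> j.
have j0 : 0 < j%:R :> R by rewrite ltr0n; near: j; exists 1%N.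
have jc : 4 * ln c / e <= j%:R.
  near: j; exists (Num.truncn (4 * ln c / e)).+1 => // m /= hm.
  by rewrite (le_trans (ltW (truncnS_gt _)))// ler_nat.
set V := [set A : {fset R} | A != fset0 /\ [set` A] `<=` range lam `&` `[j%:R, j%:R + 1[].
pose val_of (A : {fset R}) := j%:R^-1 *
  ln ((additive_energy k A)%:R `^ k%:R^-1 / (#|` A|)%:R) : R.
have hV A : V A -> 0 <= val_of A <= e.
  move=> [A0 Aj]; have Alam : [set` A] `<=` range lam by move=> a /Aj [].
  have [m hm] := block_index_bound hlam j.
  have AS n : (lam n \in A) = (n < m)%N && (lam n \in A).
    rewrite andbC; case nA : (lam n \in A) => //=; apply/esym.
    have [_] := Aj _ (nA : [set` A] (lam n)); rewrite /= in_itv/= natr1 => lj.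
    (* The monomial serves as a test polynomial: its size bounds the index of a frequency in the
       block. *)
    have := hm 'X^n; rewrite size_polyXn; apply => i.
    by rewrite coefXn; have [->|_] := eqVneq i n; rewrite ?eqxx.
  have [X0 ratioE] := energy_ratio k0 A0 AS Alam.
  set X := indp m _ in X0 ratioE.
  have jX : inblock lam j X.
    move=> n; rewrite coef_indp -AS; case nA : (lam n \in A); last by rewrite eqxx.
    by have [_] := Aj _ (nA : [set` A] (lam n)); rewrite /= in_itv/= natr1.
  have r1 : 1 <= N (2 * k)%:R X / N 2 X.
    by rewrite ler_pdivlMr// mul1r norm_mono// ler_nat leq_pmulr.
  have r2 : N (2 * k)%:R X / N 2 X <= c * expR (e / 4 * j%:R).
    rewrite ler_pdivrMr//; apply: (le_trans (hC j X jX)).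
    by rewrite !ler_wpM2r ?expR_ge0 ?(ltW X0)// le_max lexx orbT.
  rewrite /val_of ratioE; set q := _ / _ in r1 r2 *.
  have q0 : 0 < q by exact: lt_le_trans r1.
  have lnq : ln q <= ln c + e / 4 * j%:R.
    have : ln q <= ln (c * expR (e / 4 * j%:R)) by rewrite ler_ln ?posrE// mulr_gt0 ?expR_gt0.
    have -> : ln (c * expR (e / 4 * j%:R)) = ln c + e / 4 * j%:R by rewrite lnM ?expRK// posrE ?expR_gt0.
    by [].
  have lnq0 : 0 <= ln q by rewrite ln_ge0.
  rewrite lnXn// mulr2n; apply/andP; split.
    by rewrite mulr_ge0 ?invr_ge0 ?addr_ge0// ltW.
  rewrite mulrC ler_pdivrMr//; move: jc; rewrite ler_pdivrMr//; lra.
rewrite sub0r normrN /energy_exponent.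
have [->|/set0P[v Vv]] := eqVneq [set val_of A | A in V] set0.
  by rewrite sup0 normr0 ltW.
have ubV : ubound [set val_of A | A in V] e by move=> _ [A /hV /andP[_ +] <-].
have s0 : 0 <= sup [set val_of A | A in V].
  have : v <= sup [set val_of A | A in V] by apply: ub_le_sup => //; exists e.
  by apply: le_trans; case: Vv => A /hV /andP[+ _] <-.
by rewrite ger0_norm//; apply: ge_sup => //; exists v.
Unshelve. all: end_near. Qed.

(** [m] is the first index with frequency at least [j + 1]; the growth condition at its predecessor
    gives $\log\log m\le e(j+1)$, up to finitely many small indices. *)
Lemma block_size_bound (e : R) : 0 < e ->
  limn_esup (fun n : nat => (ln (ln n.+1%:R) / lam n)%:E) = 0%E ->
  exists2 C : R, 0 < C & forall j : nat, exists m I : nat,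
    [/\ forall X, inblock lam j X -> (size X <= m)%N,
        m%:R <= expR I%:R :> R & I%:R <= C * expR (e * j%:R)].
Proof.
move=> e0 hlim.
have [V [n0 _ hn0] hV] : exists2 V, nbhs \oo V &
    forall n : nat, V n -> ln (ln n.+1%:R) / lam n <= e.
  have : (limn_esup (fun n : nat => (ln (ln n.+1%:R) / lam n)%:E) < e%:E)%E.
    by rewrite hlim lte_fin.
  move=> /ereal_inf_lt[_ [V Voo <-] hlt]; exists V => // n Vn.
  rewrite -lee_fin; apply: le_trans (ltW hlt); apply: ereal_sup_ubound.
  by exists n.
pose C := expR e + n0.+2%:R + 1.
have C0 : 0 < C by rewrite !addr_gt0 ?expR_gt0.
exists C => // j.
have hex : exists n, j.+1%:R <= lam n.
  by case: hlam => _ _ /cvgryPge/(_ j.+1%:R)[n _ hn]; exists n; exact: (hn n (leqnn n)).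
have [m mj mmin] := ex_minnP hex.
pose I := (Num.truncn (expR (e * j.+1%:R) + n0.+2%:R)).+1.
have I_ge : expR (e * j.+1%:R) + n0.+2%:R <= I%:R by apply/ltW; rewrite /I truncnS_gt.
exists m, I; split.
- move=> X jX; apply/leq_sizeP => i mi; apply/eqP; apply/negPn/negP => /jX /andP[_].
  by rewrite ltNge (le_trans mj)// freq_le.
- case: m mj mmin => [|n] mj mmin; first by rewrite expR_ge0.
  have lnj : lam n < j.+1%:R.
    by rewrite ltNge; apply/negP => /mmin; rewrite ltnn.
  (* Small indices are treated apart: beyond them the limit superior bound holds, and both [lam n]
     and [ln n.+1%:R] are positive. *)
  have [nn|nn] := leqP n n0.+1.
    apply: (@le_trans _ _ (expR n0.+2%:R)); last first.
      by rewrite ler_expR (le_trans _ I_ge)// lerDr expR_ge0.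
    apply: le_trans (expR_ge1Dx _); rewrite -[n.+1%:R]natr1 addrC lerD2l ler_nat.
    exact: leq_trans nn _.
  have lam0 : 0 < lam n.
    case: (hlam) => hm _ _; apply: le_lt_trans (freq_ge0 hlam 0%N) (hm _ _ _).
    by apply: leq_trans nn.
  have := hV n (hn0 n (ltnW (ltnW nn))); rewrite ler_pdivrMr// => hll.
  have np : 0 < n.+1%:R :> R by rewrite ltr0n.
  have ln0 : 0 < ln n.+1%:R :> R by rewrite ln_gt0// ltr1n ltnS; exact: leq_ltn_trans (leq0n _) nn.
  rewrite -[leLHS]lnK ?posrE// ler_expR (le_trans _ I_ge)//.
  apply: (@le_trans _ _ (expR (e * j.+1%:R))); last by rewrite lerDl.
  rewrite -[leLHS]lnK ?posrE// ler_expR (le_trans hll)// ler_pM2l//.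
  exact: ltW.
- apply: (@le_trans _ _ (expR (e * j.+1%:R) + n0.+2%:R + 1)).
    rewrite /I -natr1 lerD2r.
    have h0 : 0 <= expR (e * j.+1%:R) + n0.+2%:R :> R by rewrite addr_ge0 ?expR_ge0.
    by have /andP[] := truncn_itv h0.
  have ej1 : 1 <= expR (e * j%:R).
    by apply: (@le_trans _ _ (expR 0)); [rewrite expR0|rewrite ler_expR mulr_ge0// ltW].
  have -> : expR (e * j.+1%:R) = expR e * expR (e * j%:R).
    by rewrite -expRD -natr1; congr expR; ring.
  rewrite /C; move: (n0.+2%:R : R) (ler0n R n0.+2) => u u0.
  rewrite !mulrDl mul1r; apply: lerD => //; rewrite lerD2l.
  by rewrite ler_peMr.
Qed.

Lemma energy_block_norm k (e : R) : (2 <= k)%N -> 0 < e ->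
  energy_exponent lam k j @[j --> \oo] --> (0 : R) ->
  exists J, forall j m S, (J <= j)%N -> inblock lam j (indp m S) ->
    N (2 * k)%:R (indp m S) <= expR (e * j%:R) * N 2 (indp m S).
Proof.
move=> k2 e0 hlim; have k0 : (0 < k)%N by exact: leq_trans k2.
have k1 : 1 <= (2 * k)%:R :> R by rewrite ler1n muln_gt0.
have n1 : 1 <= 2 :> R by rewrite ler1n.
have e20 : 0 < 2 * e by rewrite mulr_gt0.
have /cvgrPdist_le/(_ _ e20)[J _ hJ] := hlim.
(* The successor ensures [j > 0], needed to clear the factor $1/j$. *)
exists J.+1 => j m S Jj jX.
have j0 : 0 < j%:R :> R by rewrite ltr0n; apply: leq_trans Jj.
pose A : {fset R} := [fset lam (nat_of_ord i) | i in [pred i : 'I_m | S i]]%fset.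
have AS n : (lam n \in A) = (n < m)%N && S n.
  apply/imfsetP/andP => [[i /= iS /(freq_inj hlam) ->]|[nm nS]]; first by rewrite ltn_ord.
  by exists (Ordinal nm).
have [A0|A0] := eqVneq A fset0.
  have -> : indp m S = 0.
    by apply/polyP => n; rewrite coef_indp -AS A0 inE coef0.
  by rewrite !norm0// mulr0.
have Alam : [set` A] `<=` range lam by move=> _ /imfsetP[i _ ->]; exists i.
have [X0 ratioE] := energy_ratio k0 A0 AS Alam.
have := hJ j (ltnW Jj); rewrite /= sub0r normrN => hj.
set V := [set A : {fset R} | A != fset0 /\ [set` A] `<=` range lam `&` `[j%:R, j%:R + 1[].
pose val_of (A : {fset R}) := j%:R^-1 *
  ln ((additive_energy k A)%:R `^ k%:R^-1 / (#|` A|)%:R) : R.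
have VA : V A.
  split=> // a aA; split; first exact: Alam.
  have [n _ na] := Alam _ aA; rewrite -na in aA *.
  have := jX n; rewrite coef_indp -AS (aA : lam n \in A) oner_eq0 => /(_ isT).
  by rewrite /= in_itv/= natr1.
(* [sup] bounds its set only when the set is bounded, which the crude block constant provides. *)
have supV : has_sup [set val_of A | A in V].
  split; first by exists (val_of A), A.
  have [C C0 hC] := block_norm_crude hlam j.
  pose c := Num.max 1 C.
  have c0 : 0 < c by rewrite lt_max ltr01.
  exists (j%:R^-1 * ln (c ^+ 2)) => _ [B [B0 Bj] <-].
  have Blam : [set` B] `<=` range lam by move=> a /Bj [].
  have [m' hm'] := block_index_bound hlam j.
  have BS n : (lam n \in B) = (n < m')%N && (lam n \in B).
    rewrite andbC; case nB : (lam n \in B) => //=; apply/esym.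
    have [_] := Bj _ (nB : [set` B] (lam n)); rewrite /= in_itv/= natr1 => lj.
    have := hm' 'X^n; rewrite size_polyXn; apply => i.
    by rewrite coefXn; have [->|_] := eqVneq i n; rewrite ?eqxx.
  have [Y0 rE] := energy_ratio k0 B0 BS Blam; rewrite /val_of rE {rE}.
  set Y := indp m' _ in Y0 *.
  have jY : inblock lam j Y.
    move=> n; rewrite coef_indp -BS; case nB : (lam n \in B); last by rewrite eqxx.
    by have [_] := Bj _ (nB : [set` B] (lam n)); rewrite /= in_itv/= natr1.
  have r1 : 1 <= N (2 * k)%:R Y / N 2 Y.
    by rewrite ler_pdivlMr// mul1r norm_mono// ler_nat leq_pmulr.
  have r2 : N (2 * k)%:R Y / N 2 Y <= c.
    rewrite ler_pdivrMr//; apply: (le_trans (hC _ Y k1 jY)).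
    by rewrite ler_wpM2r ?(ltW Y0)// le_max lexx orbT.
  rewrite ler_pM2l ?invr_gt0// ler_ln ?posrE ?exprn_gt0 ?(lt_le_trans ltr01 r1)//.
  by rewrite lerXn2r ?nnegrE ?(le_trans ler01 r1)// ltW.
have : val_of A <= 2 * e.
  apply: (le_trans (sup_upper_bound supV _)); first by exists A.
  exact: le_trans (ler_norm _) hj.
rewrite /val_of ratioE mulrC ler_pdivrMr//.
have r1 : 1 <= N (2 * k)%:R (indp m S) / N 2 (indp m S).
  by rewrite ler_pdivlMr// mul1r norm_mono// ler_nat leq_pmulr.
set q := _ / _ in r1 *; have q0 : 0 < q by exact: lt_le_trans r1.
rewrite lnXn// mulr2n => hq.
have lnq : ln q <= e * j%:R by lra.
rewrite -ler_pdivrMr// -/q -[leLHS]lnK ?posrE//.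
by rewrite ler_expR.
Qed.

(** There are at most $Ce^{ej/2}$ level sets, each losing a factor of order $e^{ej/2}$ by the energy
    condition; the product is the allowed $e^{ej}$. *)
Lemma energy_block_bound :
  limn_esup (fun n : nat => (ln (ln n.+1%:R) / lam n)%:E) = 0%E ->
  (forall k : nat, (2 <= k)%N -> energy_exponent lam k j @[j --> \oo] --> (0 : R)) ->
  block_bound lam.
Proof.
move=> hlog hen [|[|k']]// e _ e0.
  exists 1 => // j X _; rewrite mul1r muln1.
  rewrite ler_peMl ?norm_ge0 ?ler1n//.
  by apply: (@le_trans _ _ (expR 0)); [rewrite expR0|rewrite ler_expR mulr_ge0// ltW].
set k := k'.+2; have k0 : (0 < k)%N by [].
have k1 : 1 <= (2 * k)%:R :> R by rewrite ler1n muln_gt0.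
have n1 : 1 <= 2 :> R by rewrite ler1n.
have e20 : 0 < e / 2 by rewrite divr_gt0.
have [J hJ] := energy_block_norm (isT : (2 <= k)%N) e20 (hen k isT).
have [C C0 hC] := block_size_bound e20 hlog.
have crude j : exists c : R, 0 <= c /\ forall p X, 1 <= p ->
    inblock lam j X -> N p X <= c * N 2 X.
  by have [d d0 hd] := block_norm_crude hlam j; exists d.
have [c hc] := choice crude.
(* The energy bound starts at block [J]; the finitely many earlier blocks are paid for by their
   crude constants. *)
pose Cm := \sum_(i < J) c i.
have Cm0 : 0 <= Cm by apply: sumr_ge0 => i _; exact: (hc i).1.
pose E1 : R := expR 1.
exists (Cm + (C * E1 + 1)).
  by rewrite ltr_wpDl// ltr_wpDl// mulr_ge0 ?expR_ge0// ltW.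
move=> j X jX.
have ej1 (x : R) : 0 <= x -> 1 <= expR (x * j%:R).
  by move=> x0; apply: (@le_trans _ _ (expR 0)); [rewrite expR0|rewrite ler_expR mulr_ge0].
have [jJ|Jj] := ltnP j J.
  apply: (le_trans ((hc j).2 _ X k1 jX)); apply: ler_wpM2r; first exact: norm_ge0.
  have cC : c j <= Cm.
    by rewrite /Cm (bigD1 (Ordinal jJ))//= lerDl; apply: sumr_ge0 => i _; exact: (hc i).1.
  apply: (@le_trans _ _ (Cm + (C * E1 + 1))).
    by rewrite (le_trans cC)// lerDl addr_ge0// mulr_ge0 ?expR_ge0// ltW.
  apply: ler_peMr; last exact/ej1/ltW.
  by rewrite !addr_ge0// mulr_ge0 ?expR_ge0// ltW.
have [m [I [hm mI IC]]] := hC j.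
pose F := expR (e / 2 * j%:R).
have F1 : 1 <= F by exact/ej1/ltW.
have F0 : 0 < F by exact: expR_gt0.
have FF : F * F = expR (e * j%:R) by rewrite /F -expRD -mulrDl -splitr.
apply: (@le_trans _ _ ((I%:R * (E1 * F) + 1) * N 2 X)); last first.
  apply: ler_wpM2r; first exact: norm_ge0.
  apply: (@le_trans _ _ ((C * F) * (E1 * F) + 1)).
    by rewrite lerD2r; apply: ler_wpM2r => //; rewrite mulr_ge0 ?expR_ge0// ltW.
  rewrite -FF; have -> : (C * F) * (E1 * F) = C * E1 * (F * F) by ring.
  rewrite [leRHS]mulrDl mulrDl mul1r -[leLHS]add0r; apply: lerD.
    by rewrite !mulr_ge0// ltW.
  by rewrite lerD2l mulr_ege1.
apply: (block_bound_of_nonneg hlam k0 _ _ jX).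
  by rewrite addr_ge0// !mulr_ge0 ?expR_ge0// ltW.
move=> {X jX} X jX [b b0 Xb] X1.
pose lev i := indp m (fun n => expR (- i.+1%:R) < b n <= expR (- i%:R)).
pose u n i : R := expR (- i%:R) *
  ((n < m)%N && (expR (- i.+1%:R) < b n <= expR (- i%:R)))%:R.
have u0 n i : 0 <= u n i by rewrite mulr_ge0 ?expR_ge0.
(* The majorant rounds [b n] up to $e^{-i}$ on the [i]-th level and keeps it where it is at most
   $e^{-I}$. *)
pose q n : R := \sum_(i < I) u n i + ((n < m)%N && (b n <= expR (- I%:R)))%:R * b n.
pose rest : {poly R[i]} := \poly_(n < m) ((b n <= expR (- I%:R))%R%:R * b n)%:C.
pose Q := \sum_(i < I) mulw (fun=> expR (- i%:R)) (lev i) + rest.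
have Qq n : Q`_n = (q n)%:C.
  rewrite coefD coef_sum /q rmorphD rmorph_sum /=; congr (_ + _).
    by apply: eq_bigr => i _; rewrite coef_mulw coef_indp -rmorphM mulrC.
  by rewrite coef_poly; case: (n < m)%N => //=; rewrite mul0r.
have bq n : b n <= q n.
  have sum0 : 0 <= \sum_(i < I) u n i by apply: sumr_ge0.
  have [nm|mn] := ltnP n m; last first.
    have := Xb n; rewrite nth_default ?(leq_trans (hm _ jX))// => /(congr1 (@complex.Re R)) /= <-.
    by rewrite /q addr_ge0// mulr_ge0.
  have [bI|Ib] := leP (b n) (expR (- I%:R)).
    by rewrite /q nm bI mul1r lerDr.
  (* The normalisation of the 2-norm is what lets the levels start at $e^0$. *)
  have b1 : b n <= 1.
    apply: le_trans X1; have := coef_le_norm2 (freq_inj hlam) X n.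
    by rewrite Xb normc_real ger0_norm.
  have [i iI lev_i] : exists2 i, (i < I)%N & expR (- i.+1%:R) < b n <= expR (- i%:R).
    elim: (I) Ib => [|i ih] Ib; first by move: Ib; rewrite oppr0 expR0 ltNge b1.
    have [h|h] := leP (b n) (expR (- i%:R)); first by exists i => //; rewrite Ib.
    by have [i' i'i hi'] := ih h; exists i' => //; exact: ltnW.
  rewrite /q (bigD1 (Ordinal iI))//= {1}/u nm lev_i mulr1 -addrA.
  case/andP: lev_i => _ /le_trans; apply; rewrite lerDl addr_ge0//.
    exact: sumr_ge0.
  by rewrite mulr_ge0.
have le_Q : N (2 * k)%:R X <= N (2 * k)%:R Q.
  apply: (norm_majorant lam k0 _ Qq) => n.
  by rewrite Xb normc_real ger0_norm.
apply: (le_trans le_Q); apply: (le_trans (normD _ _ _ k1)); apply: lerD; last first.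
  apply: (le_trans (norm_le_coef _ k1 (size_poly _ _))).
  apply: (@le_trans _ _ (\sum_(i < m) expR (- I%:R))).
    apply: ler_sum => i _; rewrite coef_poly ltn_ord normc_real ger0_norm ?mulr_ge0//.
    by have [h|h] := leP (b i) (expR (- I%:R)); rewrite ?mul1r// mul0r expR_ge0.
  rewrite sumr_const card_ord -[leLHS]mulr_natl expRN ler_pdivrMr ?expR_gt0//.
  by rewrite mul1r.
apply: (le_trans (norm_sum _ _ _ k1)).
apply: (@le_trans _ _ (\sum_(i < I) E1 * F)); last by rewrite sumr_const card_ord mulr_natl.
apply: ler_sum => i _.
have jl : inblock lam j (lev i).
  move=> n; rewrite coef_indp; case: andP => [[_ /andP[h _]] _|_]; last by rewrite eqxx.
  apply: jX; rewrite Xb; apply/eqP => /(congr1 (@complex.Re R)) /= b_0.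
  by move: h; rewrite b_0 ltNge expR_ge0.
apply: (le_trans (norm_scale _ _ k1 (expR_ge0 _))).
apply: (@le_trans _ _ (expR (- i%:R) * (F * N 2 (lev i)))).
  by apply: ler_wpM2l; [exact: expR_ge0|exact: hJ].
(* On the level [b n] exceeds $e^{-(i+1)}$, so rounding up costs only the factor [E1] whatever the
   level. *)
have lev2 : N 2 (lev i) <= expR i.+1%:R.
  apply: (@le_trans _ _ (expR i.+1%:R * N 2 X)); last by rewrite ler_piMr ?expR_ge0.
  apply: le_trans (norm_scale _ _ n1 (expR_ge0 _)).
  apply: (norm2_le (freq_inj hlam)) => n.
  rewrite coef_mulw Xb coef_indp -rmorphM !normc_real !ger0_norm ?mulr_ge0 ?expR_ge0//.
  case: andP => [[_ /andP[h _]]|_]; last by rewrite mulr_ge0 ?expR_ge0.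
  by rewrite mulrC -ler_pdivrMl ?expR_gt0// mulr1 -expRN ltW.
apply: (@le_trans _ _ (expR (- i%:R) * (F * expR i.+1%:R))).
  by apply: ler_wpM2l; [exact: expR_ge0|rewrite ler_pM2l].
rewrite le_eqVlt; apply/orP; left; apply/eqP.
rewrite mulrCA -expRD mulrC; congr (_ * _); rewrite /E1 -natr1; congr expR; ring.
Qed.

End Energy.

Unset Implicit Arguments.

Theorem theorem1p1 (R : realType) (lam : nat -> R) (hlam : frequency lam) :
  (hypercontractive lam <->
   (forall (sigma : R) (k : nat), 0 < sigma -> (1 <= k)%N ->
      maps_into lam sigma 2 (2 * k)%:R))
  /\
  (limn_esup (fun n : nat => (ln (ln n.+1%:R) / lam n)%:E) = 0%E ->
   (hypercontractive lam <->
    (forall k : nat, (2 <= k)%N ->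
       energy_exponent lam k j @[j --> \oo] --> (0 : R)))
   /\
   ((forall (sigma : R) (k : nat), 0 < sigma -> (1 <= k)%N ->
      maps_into lam sigma 2 (2 * k)%:R) <->
    (forall k : nat, (2 <= k)%N ->
       energy_exponent lam k j @[j --> \oo] --> (0 : R)))).
Proof.
have hM := hypercontractive_maps_into hlam.
have MB := maps_into_block_bound hlam.
have BH hB := smoothing_hypercontractive hlam (block_bound_smoothing hlam hB).
have BE := block_bound_energy hlam.
split; first by split=> [/hM|/MB/BH].
move=> hlog; have EB := energy_block_bound hlam hlog.
split; first by split=> [/hM/MB/BE|/EB/BH].
by split=> [/MB/BE|/EB/BH/hM].
Qed.
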